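(* Let $g\in\mathcal{PD}(\mathfrak{D},p)$ be a not identically zero function on $[a,b]$ (that is, $g$ does not vanish identically on at least one of its continuity intervals), where $\mathfrak{D}$, of order $n>0$, is of Fuchsian type. Then the Stieltjes transform $$S_g(z)=\int_a^b\frac{g(x)\,dx}{1-zx}$$ is analytic at the origin, and the series $$S_g(z)=\sum_{k=0}^\infty m_kz^k,\qquad m_k=\int_a^bx^kg(x)\,dx,$$ has radius of convergence $R$ which satisfies $$R\geq R^*:=\min\{|\xi|^{-1}:\ \xi\in Z_A\}$$ (with the convention $|0|^{-1}=+\infty$), where $Z_A$ is the union of the set of complex roots of the leading coefficient $p_n(x)$ of $\mathfrak{D}$ and the set $\{x_0,x_1,\dots,x_{p+1}\}$. Furthermore, for every integer $$N\geq\max\{\tau-1,\Lambda(\mathfrak{D})\}+d_n-n,$$ $S_g$ satisfies $(N,R,S(k))$-Taylor domination, where $S(k)=R^k|m_k|\,(|m_{N_0}|R^{N_0})^{-1}$ and $N_0$ is the index of the first nonzero coefficient $m_k$.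
   Context: Let $a<b$ be real. A real-valued bounded integrable function $g:[a,b]\to\mathbb{R}$ belongs to the class $\mathcal{PD}(\mathfrak{D},p)$ if it has $0\leq p<\infty$ discontinuities (not including the endpoints $a,b$), all of the first kind, and between the discontinuities it satisfies the linear homogeneous ODE $\mathfrak{D}g=0$ with polynomial coefficients, where $$\mathfrak{D}=\sum_{j=0}^np_j(x)\left(\frac{d}{dx}\right)^j,\qquad p_j(x)=\sum_{i=0}^{d_j}a_{i,j}x^i,$$ $d_j=\deg p_j$, $p_n\not\equiv0$. The discontinuities are denoted $x_1<\dots<x_p$, and $x_0=a$, $x_{p+1}=b$. Put $\tau=n(p+2)$. $\mathfrak{D}$ is of Fuchsian type if it has only regular singular points, possibly including $\infty$. $\Lambda(\mathfrak{D})$ denotes the largest positive integer characteristic exponent of $\mathfrak{D}$ at the point $\infty$ (put $\Lambda(\mathfrak{D})=0$ if there is none). Explicitly, with $\alpha=\max_j(d_j-j)$, the indicial equation of $\mathfrak{D}$ at $\infty$ is $q_\alpha(k)=0$, where $$q_\alpha(k)=\sum_{j=0}^n(-1)^ja_{\alpha+j,j}\,(k+\alpha+j)_j,\qquad (u)_j=u(u-1)\cdots(u-j+1),$$ with $a_{i,j}=0$ for $i\notin\{0,\dots,d_j\}$; so $\Lambda(\mathfrak{D})$ is the largest positive integer root of $q_\alpha$. Taylor domination: let $R$ be finite and positive, not exceeding the radius of convergence of $f(z)=\sum_{k\geq0}a_kz^k$, let $N\geq0$ be an integer, and let $S(k)\geq0$ be a sequence of subexponential growth, i.e. $\limsup_{k\to\infty}S(k)^{1/k}\leq1$.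 Then $f$ satisfies $(N,R,S(k))$-Taylor domination if $|a_k|R^k\leq S(k)\max_{i=0,\dots,N}|a_i|R^i$ for each $k\geq N+1$. *)

(* Defs.v *)
(* R[i], from mathcomp-real-closed, is the field of complex numbers. *)
From HB Require Import structures.
From mathcomp Require Import all_boot all_order all_algebra.
From mathcomp Require Import all_classical all_reals all_analysis.
From mathcomp Require Import complex.
Set Implicit Arguments.
Unset Strict Implicit.
Unset Printing Implicit Defensive.
Import Order.TTheory GRing.Theory Num.Theory.
Import numFieldNormedType.Exports.
Local Open Scope classical_set_scope.
Local Open Scope complex_scope.
Local Open Scope ring_scope.

(* The modulus with values in R; MathComp's `|z| takes its values in R[i]. *)
Notation cmod := ComplexField.Normc.normc.

(* An operator sum_(j <= n) p_j(x) (d/dx)^j is given by its order n and by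
   p : nat -> {poly K}; only the values p 0, ..., p n are used. *)

Section Fuchsian.
Context {K : fieldType}.
Implicit Types (f h : {poly K}) (p : nat -> {poly K}) (n : nat) (xi : K).

(* The rational function f / h has no pole at xi. *)
Definition analytic_quotient_at f h xi : Prop :=
  exists u v : {poly K}, v.[xi] != 0 /\ f * v = u * h.

Definition ordinary_point n p xi : Prop :=
  forall j, (j < n)%N -> analytic_quotient_at (p j) (p n) xi.

Definition singular_point n p xi : Prop := ~ ordinary_point n p xi.

Definition regular_singular_point n p xi : Prop :=
  singular_point n p xi /\
  forall j, (j < n)%N ->
    analytic_quotient_at (('X - xi%:P) ^+ (n - j) * p j) (p n) xi.

(* With w = 1/x one has d/dx = - w^2 d/dw, and [inversion_coef j i] is the
   coefficient of (d/dw)^i in (- w^2 d/dw)^j. *)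
Fixpoint inversion_coef (j i : nat) : {poly K} :=
  if j is j'.+1 then
    - 'X^2 * ((inversion_coef j' i)^`() +
              (if i is i'.+1 then inversion_coef j' i' else 0))
  else (i == 0%N)%:R.

(* w^M p(1/w), for M >= deg p *)
Definition reciprocal_poly (M : nat) f : {poly K} :=
  \poly_(l < M.+1) f`_(M - l).

(* The i-th coefficient of the operator in the variable w = 1/x, multiplied by
   a power w^M that makes all the coefficients polynomial. *)
Definition at_infinity n p (i : nat) : {poly K} :=
  let M := (\max_(j < n.+1) size (p j))%N in
  \sum_(j < n.+1) reciprocal_poly M (p j) * inversion_coef j i.

Definition fuchsian n p : Prop :=
  (forall xi, singular_point n p xi -> regular_singular_point n p xi) /\
  (singular_point n (at_infinity n p) 0 ->
   regular_singular_point n (at_infinity n p) 0).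

(* alpha = max (deg p_j - j), over the j <= n with p_j != 0 (for p_n != 0) *)
Definition alpha n p : int :=
  \big[Num.max/((size (p n)).-1%:Z - n%:Z)]_(j < n | p j != 0)
    ((size (p j)).-1%:Z - j%:Z).

Definition coefz f (i : int) : K := if i is Posz m then f`_m else 0.

Definition falling (u : K) (j : nat) : K := \prod_(l < j) (u - l%:R).

Definition indicial_infty n p (k : K) : K :=
  \sum_(j < n.+1) (-1) ^+ j * coefz (p j) (alpha n p + j%:Z) *
     falling (k + (alpha n p + j%:Z)%:~R) j.

Definition Lambda n p : nat :=
  xget 0%N [set k : nat | [/\ (0 < k)%N, indicial_infty n p k%:R = 0 &
    forall l : nat, (0 < l)%N -> indicial_infty n p l%:R = 0 -> (l <= k)%N]].

End Fuchsian.

Section PiecewiseDFinite.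
Context {R : realType}.
Implicit Types (a b : R) (n p : nat) (P : nat -> {poly R[i]}) (x : nat -> R)
  (g : R -> R).

Definition first_kind_discontinuity g (t : R) : Prop :=
  ~ {for t, continuous g} /\
  exists l r : R, g @ t^'- --> l /\ g @ t^'+ --> r.

Definition solves_ode_on n P g (I : set R) : Prop :=
  forall t, I t ->
    (forall j, (j < n)%N -> derivable (derive1n j g) t 1) /\
    \sum_(j < n.+1) (P j).[t%:C] * (derive1n j g t)%:C = 0.

(* g belongs to PD(D, p) on [a, b], for the operator D of order n with
   coefficients P; the discontinuities are x 1 < ... < x p, and x 0 = a,
   x p.+1 = b. Only the values x 0, ..., x p.+1 are used. *)
Definition class_PD a b n P p x g : Prop :=
  [/\ x 0%N = a /\ x p.+1 = b,
      forall i, (i <= p)%N -> x i < x i.+1,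
      (exists M : R, forall t, a <= t <= b -> `|g t| <= M) /\
        (@lebesgue_measure R).-integrable `[a, b] (EFin \o g),
      forall i, (0 < i <= p)%N -> first_kind_discontinuity g (x i) &
      forall i, (i <= p)%N ->
        (forall t, x i < t < x i.+1 -> {for t, continuous g}) /\
        solves_ode_on n P g `]x i, x i.+1[ ].

Definition moment a b g (k : nat) : R :=
  \int[@lebesgue_measure R]_(t in `[a, b]) (t ^+ k * g t).

Definition complex_integral a b (F : R -> R[i]) : R[i] :=
  (\int[@lebesgue_measure R]_(t in `[a, b]) complex.Re (F t)) +i*
  (\int[@lebesgue_measure R]_(t in `[a, b]) complex.Im (F t)).

Definition stieltjes a b g (z : R[i]) : R[i] :=
  complex_integral a b (fun t => (g t)%:C / (1 - z * t%:C)).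

Definition singular_set n P p x : set R[i] :=
  [set xi | root (P n) xi] `|` [set (x i)%:C | i in [set i | (i <= p.+1)%N]].

Definition inv_modulus (xi : R[i]) : \bar R :=
  if xi == 0 then +oo%E else ((cmod xi)^-1)%:E.

(* The set is finite and nonempty if P n != 0, so this infimum is a minimum. *)
Definition Rstar n P p x : \bar R :=
  ereal_inf [set inv_modulus xi | xi in singular_set n P p x].

End PiecewiseDFinite.

Section PowerSeries.
Context {R : realType}.
Implicit Types (c : nat -> R[i]) (z s : R[i]) (r : R).

(* The cast selects the topology that the norm of R[i] induces. *)
Definition power_series_sum c z s : Prop :=
  series (fun k => c k * z ^+ k) @ \oo --> (s : (R[i] : numFieldType)).

Definition has_power_series_at0 (F : R[i] -> R[i]) c : Prop :=
  exists2 r : R, 0 < r & forall z, cmod z < r -> power_series_sum c z (F z).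

Definition convergence_radius c : \bar R :=
  ereal_sup [set (cmod z)%:E | z in [set z | exists s, power_series_sum c z s]].

Definition subexponential (S : nat -> R) : Prop :=
  (limn_esup (fun k => (S k `^ (k%:R)^-1)%:E) <= 1)%E.

Definition taylor_domination c (N : nat) r (S : nat -> R) : Prop :=
  [/\ 0 < r /\ (r%:E <= convergence_radius c)%E,
      forall k, 0 <= S k,
      subexponential S &
      forall k, (N.+1 <= k)%N ->
        cmod (c k) * r ^+ k <=
        S k * \big[Num.max/0]_(i < N.+1) (cmod (c i) * r ^+ i)].

End PowerSeries.

(* Main.v *)
Require Import Defs.
From HB Require Import structures.
From mathcomp Require Import all_boot all_order all_algebra.
From mathcomp Require Import all_classical all_reals all_analysis.
From mathcomp Require Import complex.
From mathcomp Require Import ring lra zify.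
Set Implicit Arguments.
Unset Strict Implicit.
Unset Printing Implicit Defensive.
Import Order.TTheory GRing.Theory Num.Theory.
Import numFieldNormedType.Exports.
Local Open Scope classical_set_scope.
Local Open Scope complex_scope.
Local Open Scope ring_scope.

(** The two analytic claims are elementary. Since t ranges over [a, b], the
    geometric series of 1 / (1 - z t) converges uniformly as soon as
    |z| max(|a|, |b|) < 1, which gives the expansion ([stieltjes_expansion]); as
    a and b belong to the singular set, this already is the lower bound for the
    radius of convergence. Taylor domination with the given S(k) amounts to
    N0 <= N, because the maximum of |m_i| R^i over i <= N is then at least
    |m_N0| R^N0; subexponential growth of S(k) is the definition of the radius
    ([subexponential_radius]). Two facts remain.

    The first is that the radius is finite and that some moment is nonzero
    ([moment_growth]). If the moments were O(eps^k) for every eps > 0, the same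
    would hold for the integrals of u^k g, for every polynomial u that vanishes
    at 0. But u can be chosen nonnegative on [a, b] and with a sharp peak near a
    point t1 <> 0 where g <> 0, and then the integral of u^k g is at least a
    constant times L^k for some L > 0.

    The second is that the moments all vanish once m_0, ..., m_N do
    ([moments_eq0]). Let w be the product of the X - x_i over the endpoints and
    the discontinuities, and let D* be the formal adjoint of the operator. For
    every polynomial u divisible by w^n the integral of (D* u) g over [a, b] is
    zero: on each interval of continuity (D* u) g is, up to sign, the derivative
    of the bilinear concomitant of u and g, so only boundary terms are left.
    They vanish because the points are at worst regular singular. Indeed, there
    the equation bounds |t - xi|^n |g^(n)| by a multiple of the sum of the
    |t - xi|^j |g^(j)|, j < n ([fuchs_inequality_near]), and interpolation
    between g, which is bounded, and g^(n) on intervals of length proportional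
    to |t - xi| then bounds every |t - xi|^j |g^(j)|, j < n
    ([scaled_derivative_bound]). Each derivative of g in the concomitant is
    multiplied by a derivative of u that vanishes at xi to a higher order than this
    growth.

    Let tau = n (p + 2) be the degree of w^n. Taking u = w^n X^(k - tau) gives a linear relation between the moments up to
    the index k + alpha, whose leading coefficient is the value q_alpha(k) of the
    indicial polynomial at infinity ([coef_adjoint_top]). It is nonzero for
    k > Lambda, so m_(k + alpha) is determined by the preceding moments for every
    k >= max(tau, Lambda + 1) ([moment_recurrence]). Finally, regularity at
    infinity gives alpha = d_n - n ([alpha_fuchsian]), which turns this into the
    stated bound on N. As g is real and the operator complex, the real and the
    imaginary part of the equation are integrated separately. *)

(** * The operator at infinity *)

Section AtInfinity.
Context {K : fieldType}.
Implicit Types (f u v : {poly K}) (P : nat -> {poly K}).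

(** The operator - w^2 d/dw is homogeneous of degree 1 in w, hence its j-th power
    contributes a monomial of degree i + j to (d/dw)^i. *)
Lemma inversion_coefE j i :
  exists c : K, inversion_coef j i = c *: 'X^(i + j).
Proof.
elim: j i => [|j IH] i /=.
  case: i => [|i] /=; first by exists 1; rewrite scale1r expr0.
  by exists 0; rewrite scale0r.
have [c ->] := IH i.
have -> : (c *: 'X^(i + j))^`() = (c *+ (i + j)) *: 'X^((i + j).-1) :> {poly K}.
  by rewrite derivZ derivXn -scalerMnr scalerMnl.
have low : 'X^2 * ((c *+ (i + j)) *: 'X^((i + j).-1)) =
    (c *+ (i + j)) *: 'X^(i + j.+1) :> {poly K}.
  rewrite -scalerAr -exprD; case E : (i + j)%N => [|m]; first by rewrite !scale0r.
  by congr (_ *: 'X^_); lia.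
case: i low {IH} (IH i.-1) => [|i] low.
  by move=> _; exists (- c *+ (0 + j)); rewrite addr0 mulNr low mulNrn scaleNr.
case=> /= c' ->; exists (- (c *+ (i.+1 + j) + c')).
rewrite mulNr mulrDr low -scalerAr -exprD scaleNr scalerDl.
by congr (- (_ + _ *: 'X^_)); lia.
Qed.

Lemma inversion_coef_gt j i : (j < i)%N -> inversion_coef j i = 0 :> {poly K}.
Proof.
elim: j i => [|j IH] [|i] //= ji.
by rewrite IH ?(ltn_trans (ltnSn j))// IH// deriv0 addr0 mulr0.
Qed.

Lemma inversion_coef_diag j : inversion_coef j j = (-1) ^+ j *: 'X^(j + j) :> {poly K}.
Proof.
elim: j => [|j IH] /=; first by rewrite scale1r.
rewrite inversion_coef_gt// deriv0 add0r IH mulNr -scalerAr -exprD exprS mulN1r scaleNr.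
by congr (- (_ *: 'X^_)); lia.
Qed.

Lemma dvdXnP e f : reflect (forall l, (l < e)%N -> f`_l = 0) ('X^e %| f).
Proof.
apply: (iffP idP) => [/dvdpP[q ->] l le|h].
  by rewrite coefMXn le.
apply/dvdpP; exists (drop_poly e f); rewrite -[LHS](poly_take_drop e).
rewrite (_ : take_poly e f = 0) ?add0r//.
by apply/polyP => l; rewrite coef_take_poly coef0; case: ifP => // /h.
Qed.

Lemma dvdXn_quotient e f h v : v.[0] != 0 -> f * v = h -> 'X^e %| h -> 'X^e %| f.
Proof.
move=> v0 <-; rewrite Gauss_dvdpl// coprimep_expl//.
by rewrite coprimep_sym -['X]subr0 -[0]polyC0 coprimep_XsubC.
Qed.

Lemma coef_reciprocal M f l :
  (reciprocal_poly M f)`_l = if (l < M.+1)%N then f`_(M - l) else 0.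
Proof. by rewrite coef_poly. Qed.

Lemma dvdXn_reciprocal M f : (size f <= M)%N ->
  'X^(M - (size f).-1) %| reciprocal_poly M f.
Proof.
move=> fM; apply/dvdXnP => l lM; rewrite coef_reciprocal; case: ifP => // _.
rewrite nth_default//; move: (size f) fM lM => s; lia.
Qed.

(** The degree of the j-th coefficient is read off the order of vanishing at 0 of its
    reciprocal polynomial r j. Regularity at infinity concerns the coefficients Q i
    of the transformed operator, which are triangular combinations of the r j;
    solving from i = n downwards transfers the bound to the r j. *)
Lemma fuchsian_degree n P j : fuchsian n P -> P n != 0 ->
  (j <= n)%N -> P j != 0 -> ((size (P j)).-1 + n <= (size (P n)).-1 + j)%N.
Proof.
move=> [_ hinf] Pn jn Pj.
pose M := (\max_(k < n.+1) size (P k))%N.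
pose r k := reciprocal_poly M (P k).
have sizeM k : (k <= n)%N -> (size (P k) <= M)%N.
  rewrite -ltnS => kn.
  exact: (@leq_bigmax _ (fun i : 'I_n.+1 => size (P i)) (Ordinal kn)).
(* The order of vanishing at 0 of w^n r n. *)
pose E := (M - (size (P n)).-1 + n)%N.
pose Q := at_infinity n P.
have QE i : Q i = \sum_(k < n.+1) r k * inversion_coef k i by [].
have Qn : Q n = r n * ((-1) ^+ n *: 'X^(n + n)).
  rewrite QE big_ord_recr/= big1 ?add0r ?inversion_coef_diag// => k _.
  by rewrite inversion_coef_gt ?mulr0.
have dvdQn : 'X^(E + n) %| Q n.
  rewrite Qn -scalerAr; rewrite -mul_polyC dvdp_mull//.
  rewrite /E -addnA exprD dvdp_mul//.
  exact/dvdXn_reciprocal/sizeM.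
(* At an ordinary or regular singular point, w^(n-i) Q i / Q n has no pole. *)
have dvdQ i : (i < n)%N -> 'X^(E + i) %| Q i.
  move=> ltin.
  have [u [v [v0 uv]]] : analytic_quotient_at ('X^(n - i) * Q i) (Q n) 0.
    have [/hinf[_ /(_ _ ltin)]|] := pselect (singular_point n Q 0).
      by rewrite subr0.
    move=> /contrapT/(_ _ ltin)[u [v [v0 uv]]]; exists ('X^(n - i) * u), v; split=> //.
    by rewrite -!mulrA uv.
  have : 'X^(E + n) %| 'X^(n - i) * Q i.
    by apply: (dvdXn_quotient v0 uv); rewrite dvdp_mull.
  have -> : (E + n = (n - i) + (E + i))%N by lia.
  by rewrite exprD dvdp_mul2l// expf_neq0// polyX_eq0.
(* The diagonal coefficients of the triangular system are 1 or -1. *)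
have dvdr i : (i <= n)%N -> 'X^E %| r i * 'X^i.
  move=> lein; rewrite -(subKn lein).
  elim/ltn_ind: (n - i)%N (leq_subr i n) => k IH kn.
  have [->|k0] := eqVneq k 0%N.
    by rewrite subn0 /E exprD dvdp_mul// dvdXn_reciprocal// sizeM.
  set i' := (n - k)%N; have i'n : (i' < n)%N by rewrite /i'; lia.
  suff : 'X^(E + i') %| r i' * 'X^(i' + i').
    by rewrite [in X in _ %| X]exprD mulrA exprD dvdp_mul2r// expf_neq0// polyX_eq0.
  have := dvdQ _ i'n; rewrite QE (bigD1 (inord i'))//= inordK; last by lia.
  rewrite inversion_coef_diag -scalerAr dvdp_addl => [|].
    by rewrite dvdpZr// signr_eq0.
  elim/big_ind: _ => [||l hl]; [exact: dvdp0|exact: dvdp_add|].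
  have [li'|li'|li'] := ltngtP l i'.
  - by rewrite inversion_coef_gt ?mulr0.
  - have [c ->] := inversion_coefE l i'.
    rewrite -scalerAr; rewrite -mul_polyC dvdp_mull//.
    rewrite (addnC i') [X in _ %| _ * X]exprD mulrA exprD dvdp_mul//.
    have -> : (nat_of_ord l = n - (n - l))%N by have := ltn_ord l; lia.
    by apply: IH; have := ltn_ord l; rewrite /i' in li' *; lia.
  - by move/eqP: hl; case; apply/val_inj; rewrite /= inordK -?li'//; lia.
have := dvdXnP _ _ (dvdr _ jn) (M - (size (P j)).-1 + j)%N.
have := sizeM _ jn; have sj : (0 < size (P j))%N by rewrite size_poly_gt0.
have := sizeM _ (leqnn n); have sn : (0 < size (P n))%N by rewrite size_poly_gt0.
move=> sMn sMj; rewrite coefMXn [X in if X then _ else _]ltnNge leq_addl/= addnK.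
rewrite coef_reciprocal ltnS leq_subr subKn; last exact: leq_trans (leq_pred _) sMj.
case: (leqP E (M - (size (P j)).-1 + j)).
  rewrite /E; move: sn sMn sj sMj; move: (size _) (size _) => s1 s2; clear -jn; lia.
by move=> _ /(_ isT)/eqP; rewrite -/(lead_coef _) lead_coef_eq0 (negbTE Pj).
Qed.

Lemma alpha_fuchsian n P : fuchsian n P -> P n != 0 ->
  alpha n P = (size (P n)).-1%:Z - n%:Z.
Proof.
move=> hF Pn; rewrite /alpha; set d := _ - _.
elim/big_rec: _ => // j m Pj ->; apply/max_idPr.
have := fuchsian_degree hF Pn (ltnW (ltn_ord j)) Pj; rewrite /d; lia.
Qed.

End AtInfinity.

(** * The adjoint operator and the indicial equation *)

Section Adjoint.
Context {K : numFieldType}.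
Implicit Types (f u v : {poly K}) (P : nat -> {poly K}).

Definition adjoint n P u : {poly K} :=
  \sum_(j < n.+1) (-1) ^+ j *: derivn j (P j * u).

Lemma coefM_top A B f u : (size f <= A.+1)%N -> (size u <= B.+1)%N ->
  (f * u)`_(A + B) = f`_A * u`_B.
Proof.
move=> sf su; rewrite coefM (bigD1 (inord A))//= inordK ?ltnS ?leq_addr//.
rewrite addKn big1 ?addr0// => l lA.
have [lA'|lA'|lA'] := ltngtP l A.
- by rewrite [u`__]nth_default ?mulr0// (leq_trans su)//; lia.
- by rewrite nth_default ?mul0r// (leq_trans sf).
- by move/eqP: lA; case; apply/val_inj; rewrite /= inordK ?lA' ?ltnS ?leq_addr.
Qed.

Lemma falling_nat (m j : nat) : falling (m%:R : K) j = (m ^_ j)%:R.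
Proof.
rewrite /falling; elim: j => [|j IH]; first by rewrite big_ord0.
rewrite big_ord_recr/= IH ffactnSr natrM.
have [jm|jm] := leqP j m; first by rewrite natrB.
by rewrite ffact_small// !mul0r.
Qed.

Section FuchsianOperator.
Variables (n : nat) (P : nat -> {poly K}).
Hypotheses (hF : fuchsian n P) (Pn : P n != 0).
Let d := (size (P n)).-1.

(** The j-th term of the adjoint raises degrees by deg p_j - j <= alpha, so only the
    coefficient of X^(alpha + j) in p_j reaches the degree k + alpha; differentiation
    multiplies it by a falling factorial. Here alpha = d - n. *)
Lemma coef_adjoint_top k u : (n <= k)%N -> (size u <= k.+1)%N ->
  (adjoint n P u)`_(k + d - n) = indicial_infty n P k%:R * u`_k.
Proof.
move=> nk su; rewrite /adjoint coef_sum mulr_suml; apply: eq_bigr => j _.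
have jn : (j <= n)%N by rewrite -ltnS.
rewrite coefZ coef_derivn (alpha_fuchsian hF Pn) -/d -!mulrA; congr (_ * _).
have [Pj|Pj] := eqVneq (P j) 0.
  by rewrite Pj mul0r coef0 mul0rn /coefz; case: (_ + _) => ?; rewrite ?coef0 mul0r.
have := fuchsian_degree hF Pn jn Pj; rewrite -/d => sPj.
have dj : (n <= d + j)%N by rewrite (leq_trans _ sPj) ?leq_addl.
have -> : (j + (k + d - n) = (d + j - n) + k)%N by lia.
have -> : d%:Z - n%:Z + j%:Z = (d + j - n)%N%:Z by lia.
have sPj' : (size (P j) <= (d + j - n).+1)%N.
  by move: sPj; move: (size (P j)) => s; lia.
rewrite coefM_top//.
by rewrite -pmulrn -natrD falling_nat /= [(k + _)%N]addnC mulr_natl mulrnAr.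
Qed.

Lemma size_adjoint k u : (n <= k)%N -> (size u <= k.+1)%N ->
  (size (adjoint n P u) <= (k + d - n).+1)%N.
Proof.
move=> nk su; apply: (leq_trans (size_sum _ _ _)); apply/bigmax_leqP => j _.
have jn : (j <= n)%N by rewrite -ltnS.
apply/(leq_trans (size_scale_leq _ _))/leq_sizeP => i ki.
have [Pj|Pj] := eqVneq (P j) 0.
  by rewrite Pj mul0r derivn_poly0 ?size_poly0// coef0.
have := fuchsian_degree hF Pn jn Pj; rewrite -/d => sPj.
rewrite coef_derivn nth_default ?mul0rn//.
apply: (leq_trans (size_polyMleq _ _)).
by move: sPj su; move: (size (P j)) (size u) => s1 s2; lia.
Qed.

(** The term j = n has degree n in k, all others have smaller degree, and its
    coefficient is up to sign the leading coefficient of p_n: the indicial equation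
    is not trivial. *)
Lemma indicial_poly_exists :
  exists2 q : {poly K}, q != 0 & forall k, q.[k] = indicial_infty n P k.
Proof.
pose al : int := alpha n P.
pose c (j : nat) : K := (-1) ^+ j * coefz (P j) (al + j%:Z).
pose F (j : nat) := \prod_(l < j) ('X - (l%:R - (al + j%:Z)%:~R)%:P) : {poly K}.
have sF j : size (F j) = j.+1.
  by rewrite /F size_prod_XsubC /index_enum -enumT size_enum_ord.
exists (\sum_(j < n.+1) c j *: F j) => [|k]; last first.
  rewrite horner_sum /indicial_infty; apply: eq_bigr => j _.
  rewrite hornerZ horner_prod; congr (_ * _); apply: eq_bigr => l _.
  by rewrite hornerXsubC opprB addrA.
apply/eqP => /(congr1 (fun q : {poly K} => q`_n))/eqP.
rewrite coef0 coef_sum big_ord_recr/= big1 => [|j _]; last first.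
  by rewrite coefZ [_`_n]nth_default ?mulr0// sF.
have /monicP : F n \is monic by apply: monic_prod_XsubC.
rewrite add0r coefZ lead_coefE sF/= => ->; rewrite mulr1 /c /al alpha_fuchsian// subrK.
by rewrite mulf_eq0 signr_eq0 /coefz/= -/(lead_coef _) lead_coef_eq0 (negbTE Pn).
Qed.

(** With finitely many roots, a largest positive integer root exists as soon as there
    is one, so that [Lambda] does not take its default value. *)
Lemma nat_roots_bounded (q : {poly K}) : q != 0 ->
  exists B : nat, forall k : nat, root q k%:R -> (k <= B)%N.
Proof.
have [s] := ubnP (size q); elim: s q => // s IH q sq q0.
have [[k0 rk]|nr] := pselect (exists k : nat, root q k%:R); last first.
  by exists 0%N => k rk; case: nr; exists k.
move: rk q0 sq => /factor_theorem[r ->].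
have [->|r0 _] := eqVneq r 0; first by rewrite mul0r eqxx.
rewrite size_Mmonic// ?monicXsubC// size_XsubC addn2/= ltnS => /(IH _)/(_ r0)[B hB].
exists (maxn B k0) => k; rewrite rootM root_XsubC eqr_nat => /orP[/hB|/eqP ->].
  by move=> /leq_trans; apply; exact: leq_maxl.
exact: leq_maxr.
Qed.

Lemma indicial_gt_Lambda k : (Lambda n P < k)%N -> indicial_infty n P k%:R != 0.
Proof.
move=> Lk; apply/negP => /eqP qk.
have [q q0 qE] := indicial_poly_exists.
have [B hB] := nat_roots_bounded q0.
pose good l := (0 < l)%N && (q.[l%:R] == 0).
have gk : exists l, good l by exists k; rewrite /good (leq_ltn_trans _ Lk)// qE qk/=.
have gB l : good l -> (l <= B)%N by move=> /andP[_] /hB.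
case: (ex_maxnP gk gB) => l /andP[l0 ql] lmax.
have /(@xgetPex _ 0%N) : exists l : nat,
    [set k : nat | [/\ (0 < k)%N, indicial_infty n P k%:R = 0 &
    forall l : nat, (0 < l)%N -> indicial_infty n P l%:R = 0 -> (l <= k)%N]] l.
  exists l; split=> //; first by rewrite -qE; apply/eqP.
  by move=> j j0 qj; apply: lmax; rewrite /good j0 qE qj/=.
case=> _ _ /(_ k (leq_ltn_trans (leq0n _) Lk) qk) kL.
by have := leq_trans Lk kL; rewrite ltnn.
Qed.

End FuchsianOperator.
End Adjoint.

(** * Interpolation of derivatives *)

Section BoundedSolutions.
Context {R : realType}.
Implicit Types (D : nat -> R -> R) (c d h t s K M N : R).

(** The successive derivatives of D 0 are data, since the estimates below only see their
    values on [c, d]. *)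
Definition derivative_tower n D c d :=
  forall t j, c <= t <= d -> (j < n)%N -> is_derive t 1 (D j) (D j.+1 t).

Lemma derivative_towerW n D c d c' d' : c <= c' -> d' <= d ->
  derivative_tower n D c d -> derivative_tower n D c' d'.
Proof.
move=> cc dd T t j /andP[ct td]; apply: T.
by rewrite (le_trans cc ct) (le_trans td dd).
Qed.

Lemma tower_continuous n D c d j : (j < n)%N -> derivative_tower n D c d ->
  {within `[c, d], continuous (D j)}.
Proof.
move=> jn T; apply: derivable_within_continuous => t; rewrite in_itv/= => tcd.
by have [] := T t j tcd jn.
Qed.

Lemma tower_mean_value n D c d j s t : derivative_tower n D c d -> (j < n)%N ->
  c <= s -> s <= t -> t <= d ->
  exists2 y, s <= y <= t & D j t - D j s = D j.+1 y * (t - s).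
Proof.
move=> T jn cs st td; have Tst := derivative_towerW cs td T.
have dD y : y \in `]s, t[%R -> is_derive y 1 (D j) (D j.+1 y).
  by rewrite in_itv/= => /andP[sy yt]; apply: Tst => //; rewrite !ltW.
have [y yst Dy] := MVT_segment st dD (tower_continuous jn Tst).
by exists y => //; move: yst; rewrite in_itv.
Qed.

(** By induction the derivative of order j is small somewhere on each of the two outer
    thirds of the interval; the mean value theorem between these two points gives the
    next order. *)
Lemma exists_small_derivative j : exists2 K : R, 0 <= K &
  forall D c h M, 0 < h -> derivative_tower j D c (c + h) ->
    (forall t, c <= t <= c + h -> `|D 0%N t| <= M) ->
    exists2 s, c <= s <= c + h & h ^+ j * `|D j s| <= K * M.
Proof.
elim: j => [|j [K K0 IH]].
  exists 1 => // D c h M h0 _ DM; have cc : c <= c <= c + h by rewrite lexx lerDl ltW.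
  by exists c => //; rewrite expr0 !mul1r DM.
exists (2 * 3 ^+ j.+1 * K) => [|D c h M h0 T DM].
  by rewrite mulr_ge0// mulr_ge0// exprn_ge0.
pose h3 := h / 3; have h30 : 0 < h3 by rewrite divr_gt0.
have hE : h = 3 * h3 by rewrite /h3 mulrC divfK.
have sub c' : c <= c' -> c' + h3 <= c + h ->
    exists2 s, c' <= s <= c' + h3 & h3 ^+ j * `|D j s| <= K * M.
  move=> cc' c'h; apply: IH => // [t i t3 ij|t /andP[t1 t2]].
    by apply: (derivative_towerW cc' c'h T) => //; exact: ltnW.
  by apply: DM; rewrite (le_trans cc' t1) (le_trans t2 c'h).
have [||s1 /andP[s1l s1r] Ds1] := sub c; [by []|by lra|].
have [||s2 /andP[s2l s2r] Ds2] := sub (c + h3 + h3); [by lra|by lra|].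
have s12 : s1 <= s2 by lra.
have s2h : s2 <= c + h by lra.
have [y /andP[sy ys] Dy] := tower_mean_value T (ltnSn j) s1l s12 s2h.
exists y; first by apply/andP; split; lra.
have hs : h3 <= s2 - s1 by lra.
have key : h3 * `|D j.+1 y| <= `|D j s2| + `|D j s1|.
  apply: le_trans (ler_normB _ _); rewrite Dy normrM [leRHS]mulrC.
  by rewrite ler_wpM2r// (le_trans hs)// ler_norm.
have bound : h3 ^+ j.+1 * `|D j.+1 y| <= 2 * (K * M).
  rewrite exprSr -mulrA (le_trans (ler_wpM2l _ key)) ?exprn_ge0 ?(ltW h30)//.
  rewrite mulrDr (le_trans (lerD Ds2 Ds1))//; lra.
rewrite hE exprMn -[leLHS]mulrA (le_trans (ler_wpM2l _ bound)) ?exprn_ge0//.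
by rewrite le_eqVlt; apply/orP; left; apply/eqP; ring.
Qed.

(** Interpolation of Landau type, descending from the order n: each derivative is
    small somewhere, and the next one controls its oscillation. *)
Lemma derivative_interpolation n : exists2 K : R, 0 <= K &
  forall D c h M N, 0 < h -> derivative_tower n D c (c + h) ->
    (forall t, c <= t <= c + h -> `|D 0%N t| <= M) ->
    (forall t, c <= t <= c + h -> h ^+ n * `|D n t| <= N) ->
    forall j t, (j <= n)%N -> c <= t <= c + h -> h ^+ j * `|D j t| <= K * M + N.
Proof.
elim: n => [|n [K K0 IH]].
  exists 0 => // D c h M N h0 _ _ DN j t; rewrite leqn0 => /eqP-> tc.
  by rewrite mul0r add0r DN.
have [K' K'0 small] := exists_small_derivative n.
exists (K + K') => [|D c h M N h0 T DM DN j t]; first exact: addr_ge0.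
have Tn : derivative_tower n D c (c + h) by move=> u i ui /ltnW; apply: T.
have M0 : 0 <= M by apply: le_trans (DM c _) => //; rewrite lexx lerDl ltW.
rewrite leq_eqVlt => /predU1P[->|]; last first.
  rewrite ltnS => jn tc; rewrite mulrDl -addrA; apply: (IH D c h) => // {jn tc}t tc.
  have [s sc Ds] := small D c h M h0 Tn DM.
  have [y [ych osc]] : exists y, c <= y <= c + h /\ `|D n t - D n s| <= h * `|D n.+1 y|.
    wlog st : s t sc tc {Ds} / s <= t.
      have [st|/ltW ts] := leP s t; first exact.
      by move=> /(_ t s tc sc ts); rewrite distrC.
    move: sc tc => /andP[cs sh] /andP[ct th].
    have [y /andP[sy yt] ->] := tower_mean_value T (ltnSn n) cs st th.
    exists y; split; first by rewrite (le_trans cs sy) (le_trans yt th).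
    rewrite normrM mulrC ler_wpM2r// ger0_norm ?subr_ge0//; lra.
  have := DN y ych; rewrite exprSr -mulrA => Ny.
  have : `|D n t| <= `|D n s| + h * `|D n.+1 y|.
    by rewrite -lerBlDl (le_trans _ osc)// lerB_dist.
  move=> /(ler_wpM2l (exprn_ge0 n (ltW h0))); rewrite mulrDr => /le_trans; apply.
  exact: lerD.
move=> tc; apply: le_trans (DN t tc) _.
by rewrite lerDr mulr_ge0// addr_ge0.
Qed.

End BoundedSolutions.

(** * Bounded solutions near a regular singular point *)

Lemma cvg_sum_ord {R : realType} {T : Type} {F : set_system T} {FF : Filter F} n
    (f : 'I_n -> T -> R) (l : 'I_n -> R) :
  (forall i, f i @ F --> l i) -> (\sum_(i < n) f i t) @[t --> F] --> \sum_(i < n) l i.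
Proof.
elim: n f l => [|n IH] f l fl.
  under eq_fun do rewrite big_ord0; rewrite big_ord0; exact: cvg_cst.
under eq_fun do rewrite big_ord_recr/=; rewrite big_ord_recr/=.
by apply: cvgD => //; apply: IH => i; apply: fl.
Qed.

Section EndpointBounds.
Context {R : realType}.
Implicit Types (D : nat -> R -> R) (c d h t s xi r A C M : R).

(** All that is retained from the equation near a regular singular point xi. *)
Definition fuchs_inequality n D C xi t :=
  `|t - xi| ^+ n * `|D n t| <= C * \sum_(j < n) `|t - xi| ^+ j * `|D j t|.

(** Let Phi be the sum of the h^j |D j|, j < n. On an interval of length h = eps r at
    distance about r from xi, the Fuchs inequality bounds h^n |D n| by a multiple of
    eps max Phi, because r^j = eps^-j h^j with j < n. The interpolation inequality becomes max Phi <= const M + const eps max Phi, where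
    the last term is absorbed if eps is small. *)
Lemma scaled_derivative_bound n (C : R) : 0 <= C ->
  exists2 eps : R, 0 < eps <= 1 & exists2 A : R, 0 <= A &
  forall D c r xi M, 0 < r ->
    derivative_tower n D c (c + eps * r) ->
    (forall t, c <= t <= c + eps * r ->
       [/\ r <= `|t - xi| <= 2 * r, `|D 0%N t| <= M & fuchs_inequality n D C xi t]) ->
    forall t j, c <= t <= c + eps * r -> (j < n)%N ->
      `|t - xi| ^+ j * `|D j t| <= A * M.
Proof.
move=> C0; have [K K0 interp] := derivative_interpolation (R := R) n.
(* L eps is the constant in front of max Phi, hence eps makes it at most 1/2. *)
pose L : R := n%:R * (C * 2 ^+ n); have L0 : 0 <= L by rewrite !mulr_ge0 ?exprn_ge0.
pose eps := (1 + 2 * L)^-1.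
have den : 1 <= 1 + 2 * L by rewrite lerDl mulr_ge0.
have den0 : 0 < 1 + 2 * L by rewrite (lt_le_trans _ den).
have eps0 : 0 < eps by rewrite invr_gt0.
have eps1 : eps <= 1 by rewrite invf_le1.
have Leps : 2 * L * eps <= 1.
  by rewrite /eps ler_pdivrMr// mul1r lerDr.
exists eps; first by rewrite eps0.
exists (2 ^+ n * eps ^- n * (2 * (n%:R * K))) => [|D c r xi M r0 T hyp t j tc jn].
  by rewrite !mulr_ge0 ?invr_ge0 ?exprn_ge0// ltW.
pose h := eps * r; have h0 : 0 < h by rewrite mulr_gt0.
have cch : c <= c + h by rewrite lerDl ltW.
pose Phi s := \sum_(i < n) h ^+ i * `|D i s|.
have Phi_cont : {within `[c, c + h], continuous Phi}.
  apply/subspace_continuousP => s sc; apply: cvg_sum_ord => i.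
  apply: cvgMr; apply: cvg_norm.
  by have /subspace_continuousP := tower_continuous (ltn_ord i) T; apply.
(* Absorbing requires a finite maximum, attained at s0. *)
have [s0 s0c s0max] := EVT_max cch Phi_cont.
have top s : c <= s <= c + h -> h ^+ n * `|D n s| <= C * 2 ^+ n * eps * Phi s0.
  move=> sc; have [/andP[rs sr] _ ode] := hyp s sc.
  have : h ^+ n * `|D n s| <= eps ^+ n * (`|s - xi| ^+ n * `|D n s|).
    rewrite /h exprMn -mulrA ler_wpM2l ?exprn_ge0 ?(ltW eps0)// ler_wpM2r//.
    by rewrite lerXn2r// nnegrE ?(ltW r0)// (le_trans (ltW r0)).
  move=> /le_trans; apply; apply: le_trans (ler_wpM2l (exprn_ge0 _ (ltW eps0)) ode) _.
  rewrite mulrCA -!mulrA ler_wpM2l//.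
  have : Phi s <= Phi s0 by apply: s0max; rewrite in_itv.
  move=> /(ler_wpM2l (ltW eps0))/(ler_wpM2l (exprn_ge0 n (ler0n R 2))).
  move=> /(le_trans _); apply.
  rewrite /Phi !mulr_sumr; apply: ler_sum => i _.
  have e1 : eps ^+ n <= eps ^+ i.+1 by rewrite ler_wiXn2l ?(ltW eps0).
  have e2 : `|s - xi| ^+ i <= 2 ^+ n * r ^+ i.
    apply: (@le_trans _ _ ((2 * r) ^+ i)).
      by rewrite lerXn2r// nnegrE mulr_ge0// ltW.
    rewrite exprMn ler_wpM2r ?exprn_ge0 ?(ltW r0)// ler_weXn2l ?ler1n//.
    exact: ltnW.
  rewrite !mulrA ler_wpM2r// /h exprMn.
  have -> : 2 ^+ n * eps * (eps ^+ i * r ^+ i) = eps ^+ i.+1 * (2 ^+ n * r ^+ i).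
    by rewrite exprS; ring.
  by apply: ler_pM; rewrite ?exprn_ge0 ?(ltW eps0).
have M0 : 0 <= M by have [|_ + _] := hyp c; [rewrite lexx|exact: le_trans].
have bound i s : (i <= n)%N -> c <= s <= c + h ->
    h ^+ i * `|D i s| <= K * M + C * 2 ^+ n * eps * Phi s0.
  by apply: (interp D c h) => // s' /hyp[].
have Phi_bound : Phi s0 <= 2 * (n%:R * K) * M.
  have : Phi s0 <= \sum_(i < n) (K * M + C * 2 ^+ n * eps * Phi s0).
    by apply: ler_sum => i _; apply: bound; [exact: ltnW|move: s0c; rewrite in_itv].
  rewrite sumr_const card_ord -[X in _ <= X]mulr_natl => PhiL.
  have PhiE : n%:R * (K * M + C * 2 ^+ n * eps * Phi s0) =
      n%:R * K * M + L * eps * Phi s0.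
    by rewrite /L; ring.
  have Phi0 : 0 <= Phi s0 by apply: sumr_ge0 => i _; rewrite mulr_ge0// exprn_ge0// ltW.
  have := ler_wpM2r Phi0 Leps; rewrite mul1r => Lhalf.
  rewrite PhiE in PhiL; lra.
have [/andP[rt tr] _ _] := hyp t tc.
have Dj : h ^+ j * `|D j t| <= Phi s0.
  apply: le_trans (s0max t _); last by rewrite in_itv.
  rewrite /Phi (bigD1 (Ordinal jn))//= lerDl sumr_ge0// => i _.
  by rewrite mulr_ge0// exprn_ge0// ltW.
have : `|t - xi| ^+ j * `|D j t| <= 2 ^+ n * eps ^- n * (h ^+ j * `|D j t|).
  rewrite mulrA ler_wpM2r//; apply: (@le_trans _ _ ((2 * r) ^+ j)).
    by rewrite lerXn2r// nnegrE mulr_ge0// ltW.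
  rewrite /h !exprMn -!mulrA ler_pM ?exprn_ge0 ?(ltW r0)//.
    by rewrite ler_weXn2l ?ler1n// ltnW.
  rewrite mulrA ler_peMl ?exprn_ge0 ?(ltW r0)// ler_pdivlMl ?exprn_gt0// mulr1.
  by rewrite ler_wiXn2l ?(ltW eps0)// ltnW.
move=> /le_trans; apply; rewrite -!mulrA !ler_wpM2l ?invr_ge0 ?exprn_ge0 ?(ltW eps0)//.
by apply: (le_trans Dj); rewrite !mulrA in Phi_bound *.
Qed.

(** The interval [t, t + eps (t - c)] stays inside the region where the Fuchs
    inequality holds, at a distance between t - c and 2 (t - c) from c. *)
Lemma right_endpoint_bound n D C c d M : 0 <= C -> c < d ->
  (forall t j, c < t < d -> (j < n)%N -> is_derive t 1 (D j) (D j.+1 t)) ->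
  (forall t, c < t < d -> `|D 0%N t| <= M) ->
  (\forall t \near c^'+, fuchs_inequality n D C c t) ->
  exists A, \forall t \near c^'+, forall j, (j < n)%N -> `|t - c| ^+ j * `|D j t| <= A.
Proof.
move=> C0 cd T DM.
have [eps /andP[eps0 eps1] [A A0 key]] := scaled_derivative_bound n C0.
move=> [/= del del0 ode]; exists (A * M).
near=> t => j jn.
have ct : c < t by near: t; exact: nbhs_right_gt.
have td : t - c < Num.min del (d - c) / 2.
  by near: t; apply: nbhs_right_ltDr; rewrite divr_gt0// lt_min del0 subr_gt0.
have [t1 t2] : 2 * (t - c) < del /\ 2 * (t - c) < d - c.
  by move: td; rewrite ltr_pdivlMr// mulrC lt_min => /andP[].
have er : eps * (t - c) <= t - c by rewrite ler_piMl// subr_ge0 ltW.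
have e0 : 0 < eps * (t - c) by rewrite mulr_gt0// subr_gt0.
apply: (key D t (t - c) c M); rewrite ?subr_gt0 ?lexx ?lerDl ?(ltW e0)//.
  by move=> s i /andP[ts st] ni; apply: T => //; apply/andP; split; lra.
move=> s /andP[ts st]; have cs : c < s by lra.
rewrite [X in _ <= X <= _]gtr0_norm ?subr_gt0//; split.
- by apply/andP; split; lra.
- by apply: DM; apply/andP; split; lra.
- by apply: ode => //=; rewrite distrC gtr0_norm ?subr_gt0//; lra.
Unshelve. all: by end_near. Qed.

(** As before, with the interval [t - eps (d - t), t]. *)
Lemma left_endpoint_bound n D C c d M : 0 <= C -> c < d ->
  (forall t j, c < t < d -> (j < n)%N -> is_derive t 1 (D j) (D j.+1 t)) ->
  (forall t, c < t < d -> `|D 0%N t| <= M) ->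
  (\forall t \near d^'-, fuchs_inequality n D C d t) ->
  exists A, \forall t \near d^'-, forall j, (j < n)%N -> `|t - d| ^+ j * `|D j t| <= A.
Proof.
move=> C0 cd T DM.
have [eps /andP[eps0 eps1] [A A0 key]] := scaled_derivative_bound n C0.
move=> [/= del del0 ode]; exists (A * M).
near=> t => j jn.
have td : t < d by near: t; exact: nbhs_left_lt.
have ct : d - t < Num.min del (d - c) / 2.
  by near: t; apply: nbhs_left_ltBl; rewrite divr_gt0// lt_min del0 subr_gt0.
have [t1 t2] : 2 * (d - t) < del /\ 2 * (d - t) < d - c.
  by move: ct; rewrite ltr_pdivlMr// mulrC lt_min => /andP[].
have er : eps * (d - t) <= d - t by rewrite ler_piMl// subr_ge0 ltW.
have e0 : 0 < eps * (d - t) by rewrite mulr_gt0// subr_gt0.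
have rE : t - eps * (d - t) + eps * (d - t) = t by rewrite subrK.
apply: (key D (t - eps * (d - t)) (d - t) d M); rewrite ?rE ?subr_gt0//.
- by move=> s i /andP[ts st] ni; apply: T => //; apply/andP; split; lra.
- move=> s /andP[ts st]; have sd : s < d by lra.
  rewrite [X in _ <= X <= _]distrC gtr0_norm ?subr_gt0//; split.
  + by apply/andP; split; lra.
  + by apply: DM; apply/andP; split; lra.
  + by apply: ode => //=; rewrite gtr0_norm ?subr_gt0//; lra.
- by apply/andP; split; lra.
Unshelve. all: by end_near. Qed.

End EndpointBounds.

(** * The Lagrange identity *)

Section LagrangeIdentity.
Context {R : realType}.
Implicit Types (D : nat -> R -> R) (v : {poly R}) (t xi A : R).

(** The bilinear concomitant of v and D 0 for the operator (d/dt)^j, that is, the sum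
    over l < j of (-1)^l v^(l) D (j-1-l). *)
Fixpoint concomitant D j v t : R :=
  if j is j'.+1 then v.[t] * D j' t - concomitant D j' v^`() t else 0.

(** Lagrange's identity for the operator (d/dt)^j. *)
Lemma is_derive_concomitant D j v t :
  (forall i, (i < j)%N -> is_derive t 1 (D i) (D i.+1 t)) ->
  is_derive t 1 (concomitant D j v)
    (v.[t] * D j t - ((-1) ^+ j *: derivn j v).[t] * D 0%N t).
Proof.
elim: j v => [|j IH] v T.
  rewrite expr0 scale1r derivn0 subrr; exact: is_derive_cst.
have Dj := T j (ltnSn j).
have {}IH := IH v^`() (fun i ij => T i (ltnW ij)).
have -> : concomitant D j.+1 v = (horner v * D j)%R - concomitant D j v^`().
  by apply/funext => s.
apply: is_derive_eq; rewrite -[_ *: D j.+1 t]/(_ * _) -[_ *: v^`().[t]]/(_ * _).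
by rewrite -derivSn exprS mulN1r scaleNr hornerN; ring.
Qed.

Lemma deriv_dvd_XsubCX e v xi :
  ('X - xi%:P) ^+ e.+1 %| v -> ('X - xi%:P) ^+ e %| v^`().
Proof.
move=> /dvdpP[q ->]; rewrite derivM deriv_exp derivXsubC mul1r dvdp_add//.
  by rewrite exprS mulrA dvdp_mull.
by rewrite mulrnAr -mulrnAl dvdp_mull.
Qed.

(** In the terms v^(l) D (j-1-l), the first factor vanishes at xi to the order
    j - l at least, and the second one grows at most like |t - xi|^-(j-1-l). *)
Lemma cvg_concomitant D j v xi A (F : set_system R) {FF : ProperFilter F} :
  F `=>` nbhs xi ->
  (\forall t \near F, forall i, (i < j)%N -> `|t - xi| ^+ i * `|D i t| <= A) ->
  ('X - xi%:P) ^+ j %| v -> concomitant D j v @ F --> 0.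
Proof.
move=> Fxi; elim: j v => [|j IH] v bound dv; first exact: cvg_cst.
rewrite -[0]subr0; apply: cvgB; last first.
  apply: IH; last exact: deriv_dvd_XsubCX.
  by apply: filterS bound => t h i /ltnW; apply: h.
move: dv => /dvdpP[q ->].
have small : (`|q.[t] * (t - xi)| * A) @[t --> F] --> 0.
  rewrite (_ : 0 = `|q.[xi] * (xi - xi)| * A); last by rewrite subrr mulr0 normr0 mul0r.
  apply: cvg_trans (cvg_app _ Fxi) _.
  apply: cvgMl; apply: cvg_norm; apply: cvgM; first exact: continuous_horner.
  by apply: cvgB; [exact: cvg_id|exact: cvg_cst].
apply/norm_cvg0P; apply: (squeeze_cvgr _ (cvg_cst 0) small).
near=> t; rewrite normr_ge0/= exprS mulrA !hornerM horner_exp hornerXsubC.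
rewrite [(q.[t] * _) * _]mulrC -mulrA.
rewrite mulrCA normrM ler_wpM2l// normrM normrX.
near: t; apply: filterS bound => t; exact.
Unshelve. all: by end_near. Qed.

End LagrangeIdentity.

Section VanishingIntegral.
Context {R : realType}.
Notation mu := (@lebesgue_measure R).
Implicit Types (D : nat -> R -> R) (u : {poly R}) (Q : nat -> {poly R}) (c d t A : R).

(** By Lagrange's identity the integral over [s, t], c < s < t < d, is the difference of
    the values at s and t of the concomitant B, which tends to 0 at both ends. The
    limits are taken one after the other, s -> c and then t -> d. *)
Lemma integral_adjoint_eq0 n Q D u c d Ac Ad : c < d ->
  (forall t j, c < t < d -> (j < n)%N -> is_derive t 1 (D j) (D j.+1 t)) ->
  (forall t, c < t < d -> {for t, continuous (D 0%N)}) ->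
  (forall t, c < t < d -> \sum_(j < n.+1) (Q j).[t] * D j t = 0) ->
  (\forall t \near c^'+, forall j, (j < n)%N -> `|t - c| ^+ j * `|D j t| <= Ac) ->
  (\forall t \near d^'-, forall j, (j < n)%N -> `|t - d| ^+ j * `|D j t| <= Ad) ->
  ('X - c%:P) ^+ n %| u -> ('X - d%:P) ^+ n %| u ->
  mu.-integrable `[c, d] (EFin \o (fun t => (adjoint n Q u).[t] * D 0%N t)) ->
  \int[mu]_(t in `[c, d]) ((adjoint n Q u).[t] * D 0%N t) = 0.
Proof.
move=> cd T cont ode bc bd uc ud intf.
pose f t := (adjoint n Q u).[t] * D 0%N t.
pose B t := \sum_(j < n.+1) concomitant D j (Q j * u) t.
have dB t : c < t < d -> is_derive t 1 B (- f t).
  move=> tcd.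
  have -> : B = \sum_(j < n.+1) concomitant D j (Q j * u).
    by apply/funext => s; rewrite fct_sumE.
  have dBj (j : 'I_n.+1) : is_derive t 1 (concomitant D j (Q j * u))
      ((Q j * u).[t] * D j t - ((-1) ^+ j *: derivn j (Q j * u)).[t] * D 0%N t).
    apply: is_derive_concomitant => i ij; apply: T => //.
    by rewrite (leq_trans ij)// -ltnS.
  apply: (is_derive_eq (is_derive_sum dBj)).
  rewrite big_split/= sumrN -mulr_suml -horner_sum -/(f t).
  under eq_bigr do rewrite hornerM mulrAC mulrC.
  by rewrite -mulr_sumr ode// mulr0 add0r.
have endB xi A (F : set_system R) (FF : ProperFilter F) : F `=>` nbhs xi ->
    (\forall t \near F, forall j, (j < n)%N -> `|t - xi| ^+ j * `|D j t| <= A) ->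
    ('X - xi%:P) ^+ n %| u -> B @ F --> 0.
  move=> Fxi bound dvu.
  have -> : (0 : R) = \sum_(j < n.+1) 0 by rewrite big1.
  apply: cvg_sum_ord => j; have jn : (j <= n)%N by rewrite -ltnS.
  apply: (cvg_concomitant (xi := xi) (A := A)) => //.
    by apply: filterS bound => t h i ij; apply: h; exact: leq_trans ij jn.
  by rewrite dvdp_mull// (dvdp_trans _ dvu)// dvdp_exp2l.
have Bc : B @ c^'+ --> 0 by apply: endB bc uc; exact: cvg_within.
have Bd : B @ d^'- --> 0 by apply: endB bd ud; exact: cvg_within.
pose F x := \int[mu]_(t in `[c, x]) f t.
have Fc : F @ c^'+ --> 0.
  exact/cvg_at_right_filter/(parameterized_integral_cvg_left cd intf).
have Fd : F @ d^'- --> F d by exact: parameterized_integral_cvg_at_left.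
have sub s t : c <= s -> t <= d -> mu.-integrable `[s, t] (EFin \o f).
  by move=> cs td; apply: integrableS intf => //; apply: subset_itv; rewrite bnd_simp.
have FB s t : c < s -> s < t -> t < d -> F t - F s = B s - B t.
  move=> cs st td.
  rewrite /F Rintegral_itvB ?bnd_simp ?(ltW st)//; last 2 first.
  - exact: sub (lexx c) (ltW td).
  - exact: ltW.
  rewrite Rintegral_itv_obnd_cbnd; last first.
    apply: integrableS (sub s t (ltW cs) (ltW td)) => //.
    by apply: subset_itv; rewrite bnd_simp.
  rewrite /Rintegral.
  have dB' y : s <= y <= t -> is_derive y 1 (- B) (f y).
    move=> /andP[sy yt]; rewrite -[f y]opprK; apply: is_deriveN.
    by apply: dB; rewrite (lt_le_trans cs sy) (le_lt_trans yt td).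
  rewrite (@continuous_FTC2 _ f (- B))//.
  - by rewrite /= opprK addrC.
  - apply: continuous_in_subspaceT => y; rewrite inE/= in_itv/= => /andP[sy yt].
    apply: continuousM; first exact: continuous_horner.
    by apply: cont; rewrite (lt_le_trans cs sy) (le_lt_trans yt td).
  - have cB y : s <= y <= t -> {for y, continuous (- B)}.
      move=> /dB'[h _]; exact/differentiable_continuous/derivable1_diffP.
    split=> [y||].
    + by rewrite in_itv/= => /andP[sy yt]; have [] := dB' y; rewrite ?ltW.
    + by apply/cvg_at_right_filter/cB; rewrite lexx ltW.
    + by apply/cvg_at_left_filter/cB; rewrite lexx ltW.
  - move=> y; rewrite in_itv/= => /andP[sy yt]; rewrite derive1E.
    by have [|_ ->] := dB' y; rewrite ?ltW.
have FBt t : c < t < d -> F t + B t = 0.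
  move=> /andP[ct td].
  have lim0 : F s + B s @[s --> c^'+] --> (0 : R).
    by rewrite -[X in _ --> X]addr0; apply: cvgD.
  have limt : F s + B s @[s --> c^'+] --> F t + B t.
    apply: cvg_near_cst; near=> s.
    have cs : c < s by near: s; exact: nbhs_right_gt.
    have st : s < t by near: s; exact: nbhs_right_lt.
    by have := FB s t cs st td; lra.
  exact: (norm_cvg_unique limt lim0).
have limF : F s + B s @[s --> d^'-] --> F d.
  by rewrite -[X in _ --> X]addr0; apply: cvgD.
have lim0 : F s + B s @[s --> d^'-] --> (0 : R).
  apply: cvg_near_cst; near=> s; apply: FBt; apply/andP; split.
    by near: s; exact: nbhs_left_gt.
  by near: s; exact: nbhs_left_lt.
exact: (norm_cvg_unique limF lim0).
Unshelve. all: by end_near. Qed.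

End VanishingIntegral.

(** * Complex coefficients on the real line *)

Section ComplexModulus.
Context {R : realType}.
Implicit Types (v : {poly R[i]}) (z w : R[i]) (t x : R).

Lemma cmodM z w : cmod (z * w) = cmod z * cmod w.
Proof. exact: ComplexField.Normc.normcM. Qed.

Lemma cmodR t : cmod t%:C = `|t|.
Proof. by rewrite /= expr0n /= addr0 sqrtr_sqr. Qed.

Lemma cmod_ge0 z : 0 <= cmod z.
Proof. by case: z => a b; exact: sqrtr_ge0. Qed.

Lemma cmod_gt0 z : (0 < cmod z) = (z != 0).
Proof.
rewrite lt0r cmod_ge0 andbT; apply/idP/idP; apply: contra => /eqP.
  by move=> ->; rewrite ComplexField.Normc.normc0.
by move=> /ComplexField.Normc.eq0_normc ->.
Qed.

Lemma cmodX z k : cmod (z ^+ k) = cmod z ^+ k.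
Proof.
elim: k => [|k IH]; first by rewrite !expr0 ComplexField.Normc.normc1.
by rewrite !exprS cmodM IH.
Qed.

Lemma cmod_sum n (F : 'I_n -> R[i]) : cmod (\sum_i F i) <= \sum_i cmod (F i).
Proof.
elim/big_ind2 : _ => [|z s w r zs wr|//]; first by rewrite ComplexField.Normc.normc0.
by apply: le_trans (le_normcD _ _) _; exact: lerD.
Qed.

Lemma Re_le_cmod z : `|complex.Re z| <= cmod z.
Proof.
by case: z => x y /=; rewrite -sqrtr_sqr ler_wsqrtr// lerDl sqr_ge0.
Qed.

Lemma Im_le_cmod z : `|complex.Im z| <= cmod z.
Proof.
by case: z => x y /=; rewrite -sqrtr_sqr ler_wsqrtr// lerDr sqr_ge0.
Qed.

Lemma cmod_le_parts z : cmod z <= `|complex.Re z| + `|complex.Im z|.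
Proof.
case: z => x y /=; rewrite -[leRHS]ger0_norm ?addr_ge0// -sqrtr_sqr ler_wsqrtr//.
rewrite sqrrD !real_normK ?num_real// -addrA [X in _ <= _ + X]addrC addrA lerDl.
by rewrite mulrn_wge0// mulr_ge0.
Qed.

Lemma ReD z w : complex.Re (z + w) = complex.Re z + complex.Re w.
Proof. by case: z; case: w. Qed.

Lemma ImD z w : complex.Im (z + w) = complex.Im z + complex.Im w.
Proof. by case: z; case: w. Qed.

Lemma Re_sum n (F : 'I_n -> R[i]) : complex.Re (\sum_i F i) = \sum_i complex.Re (F i).
Proof. exact: (big_morph _ ReD erefl). Qed.

Lemma Im_sum n (F : 'I_n -> R[i]) : complex.Im (\sum_i F i) = \sum_i complex.Im (F i).
Proof. exact: (big_morph _ ImD erefl). Qed.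

Lemma ReMr z t : complex.Re (z * t%:C) = complex.Re z * t.
Proof. by case: z => a b /=; rewrite mulr0 subr0. Qed.

Lemma ImMr z t : complex.Im (z * t%:C) = complex.Im z * t.
Proof. by case: z => a b /=; rewrite mulr0 add0r. Qed.

Lemma Re_horner v t : complex.Re v.[t%:C] = (map_poly (@complex.Re R) v).[t].
Proof.
rewrite horner_poly horner_coef Re_sum.
by apply: eq_bigr => i _; rewrite -rmorphXn ReMr.
Qed.

Lemma Im_horner v t : complex.Im v.[t%:C] = (map_poly (@complex.Im R) v).[t].
Proof.
rewrite horner_poly horner_coef Im_sum.
by apply: eq_bigr => i _; rewrite -rmorphXn ImMr.
Qed.

Lemma continuous_cmod_horner v : continuous (fun t : R => cmod v.[t%:C]).
Proof.
move=> x.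
have -> : (fun t : R => cmod v.[t%:C]) =
    Num.sqrt \o horner
      (map_poly (@complex.Re R) v ^+ 2 + map_poly (@complex.Im R) v ^+ 2).
  apply/funext => t; rewrite /= hornerD !horner_exp -Re_horner -Im_horner.
  by case: v.[_].
apply: continuous_comp; [exact: continuous_horner|exact: sqrt_continuous].
Qed.

Lemma near_root_free v x : v != 0 -> \forall t \near x^', v.[t%:C] != 0.
Proof.
move=> v0; have [m [w w0 vE]] := multiplicity_XsubC v x%:C.
rewrite v0 /root in w0.
have : \forall t \near x^', 0 < cmod w.[t%:C].
  apply: nbhs_dnbhs; have := @continuous_cmod_horner w x.
  by move=> /cvgr_gt; apply; rewrite cmod_gt0.
apply: filterS2 (nbhs_dnbhs_neq x) => t tx.
rewrite cmod_gt0 vE hornerM horner_exp hornerXsubC => wt.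
rewrite mulf_neq0// expf_neq0// subr_eq0.
by apply: contra tx => /eqP/complexI/eqP.
Qed.

(** The quotient of (t - x)^(n-j) p_j by p_n is u / v with v nonzero at x, hence it is
    bounded near x. An ordinary point is covered by multiplying its quotient by
    (t - x)^(n-j). *)
Lemma regular_coefficient_bound n (P : nat -> {poly R[i]}) x j :
  P n != 0 -> (forall xi, singular_point n P xi -> regular_singular_point n P xi) ->
  (j < n)%N -> exists2 C : R, 0 <= C & \forall t \near x^',
    `|t - x| ^+ (n - j) * cmod (P j).[t%:C] <= C * cmod (P n).[t%:C].
Proof.
move=> Pn hreg jn.
have [u [v [v0 uv]]] :
    analytic_quotient_at (('X - x%:C%:P) ^+ (n - j) * P j) (P n) x%:C.
  have [/hreg[_ /(_ _ jn)//]|] := pselect (singular_point n P x%:C).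
  move=> /contrapT/(_ _ jn)[u [v [v0 uv]]].
  by exists (('X - x%:C%:P) ^+ (n - j) * u), v; split=> //; rewrite -!mulrA uv.
have v1 : 0 < cmod v.[x%:C] by rewrite cmod_gt0.
exists ((cmod u.[x%:C] + 1) / (cmod v.[x%:C] / 2)).
  by rewrite divr_ge0 ?addr_ge0 ?divr_ge0 ?cmod_ge0.
have nu : \forall t \near x^', cmod u.[t%:C] < cmod u.[x%:C] + 1.
  apply: nbhs_dnbhs; have := @continuous_cmod_horner u x.
  by move=> /cvgr_lt; apply; rewrite ltrDl.
have nv : \forall t \near x^', cmod v.[x%:C] / 2 < cmod v.[t%:C].
  apply: nbhs_dnbhs; have := @continuous_cmod_horner v x.
  by move=> /cvgr_gt; apply; rewrite ltr_pdivrMr// ltr_pMr// ltr1n.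
apply: filterS2 nu nv => t nu nv.
have := congr1 (fun q : {poly R[i]} => cmod q.[t%:C]) uv.
rewrite !hornerM horner_exp hornerXsubC !cmodM cmodX -rmorphB cmodR => uvt.
rewrite mulrAC ler_pdivlMr ?divr_gt0//.
apply: le_trans (ler_wpM2l _ (ltW nv)) _.
  by rewrite mulr_ge0 ?exprn_ge0 ?cmod_ge0.
by rewrite uvt ler_wpM2r ?cmod_ge0// ltW.
Qed.

(** Multiply the equation by |t - x|^n, divide it by p_n, and bound the coefficients by
    [regular_coefficient_bound]. The constant and the neighbourhood depend on the
    operator only. *)
Lemma fuchs_inequality_near n (P : nat -> {poly R[i]}) x :
  P n != 0 -> (forall xi, singular_point n P xi -> regular_singular_point n P xi) ->
  exists2 C : R, 0 <= C & \forall t \near x^', forall D : nat -> R -> R,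
    \sum_(j < n.+1) (P j).[t%:C] * (D j t)%:C = 0 -> fuchs_inequality n D C x t.
Proof.
move=> Pn hreg.
have /choice[C hC] (j : 'I_n) : exists C : R, 0 <= C /\ \forall t \near x^',
    `|t - x| ^+ (n - j) * cmod (P j).[t%:C] <= C * cmod (P n).[t%:C].
  by have [C C0 h] := regular_coefficient_bound x Pn hreg (ltn_ord j); exists C.
exists (\sum_j C j); first by apply: sumr_ge0 => j _; have [] := hC j.
have hnear : \forall t \near x^', forall j : 'I_n,
    `|t - x| ^+ (n - j) * cmod (P j).[t%:C] <= C j * cmod (P n).[t%:C].
  by apply: filter_forall => j; have [] := hC j.
apply: filterS2 hnear (near_root_free x Pn) => t bound Pt D ode.
rewrite /fuchs_inequality -(ler_pM2l (_ : 0 < cmod (P n).[t%:C])) ?cmod_gt0//.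
have lead : cmod (P n).[t%:C] * `|D n t| <= \sum_(j < n) cmod (P j).[t%:C] * `|D j t|.
  move: ode; rewrite big_ord_recr/= => /eqP; rewrite addrC addr_eq0 => /eqP ode.
  rewrite -cmodR -cmodM ode normcN (le_trans (cmod_sum _))//.
  by apply: ler_sum => j _; rewrite cmodM cmodR.
rewrite mulrCA; apply: le_trans (ler_wpM2l (exprn_ge0 _ (normr_ge0 _)) lead) _.
rewrite [leRHS]mulrA mulrC mulr_suml mulr_sumr; apply: ler_sum => j _; rewrite mulrC.
have -> : `|t - x| ^+ n * (cmod (P j).[t%:C] * `|D j t|) =
    (`|t - x| ^+ (n - j) * cmod (P j).[t%:C]) * (`|t - x| ^+ j * `|D j t|).
  have -> : `|t - x| ^+ n = `|t - x| ^+ (n - j) * `|t - x| ^+ j.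
    by rewrite -exprD subnK// ltnW.
  by ring.
rewrite ler_wpM2r ?mulr_ge0 ?exprn_ge0//; apply: le_trans (bound j) _.
rewrite mulrC ler_wpM2l ?cmod_ge0// (bigD1 j)//= lerDl sumr_ge0// => i _.
by have [] := hC i.
Qed.

End ComplexModulus.

(** * Integrals against polynomials *)

Section Moments.
Context {R : realType}.
Notation mu := (@lebesgue_measure R).
Implicit Types (a b c d t B : R) (g h : R -> R) (q : {poly R}).

Lemma integrable_bounded_mul a b g h B :
  mu.-integrable `[a, b] (EFin \o g) ->
  measurable_fun (`[a, b]%classic : set (measurableTypeR R)) h ->
  (forall t, a <= t <= b -> `|h t| <= B) ->
  mu.-integrable `[a, b] (EFin \o (fun t => h t * g t)).
Proof.
move=> ig mh hB.
suff hb : [bounded h t | t in (`[a, b]%classic : set (measurableTypeR R))].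
  have mD : measurable (`[a, b]%classic : set (measurableTypeR R)) by [].
  have I := integrableMr mD mh hb ig.
  exact: I.
exists B; split; first exact: num_real.
move=> M BM t /=; rewrite in_itv/= => tab.
exact: le_trans (hB t tab) (ltW BM).
Qed.

Lemma horner_bounded q a b : exists B, forall t, a <= t <= b -> `|q.[t]| <= B.
Proof.
have [B hB] := poly_disk_bound q (`|a| + `|b|).
exists B => t /andP[ta tb]; apply: hB; rewrite ler_norml.
have := ler_norm b; have := ler_norm (- a); rewrite normrN => na nb.
by have := normr_ge0 a; have := normr_ge0 b => b0 a0; apply/andP; split; lra.
Qed.

Lemma measurable_horner (D : set (measurableTypeR R)) q : measurable_fun D (horner q).
Proof.
apply: measurable_funTS.
exact: (measurable_realfun.continuous_measurable_fun (@continuous_horner R q)).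
Qed.

Lemma integrable_horner_mul a b g q :
  mu.-integrable `[a, b] (EFin \o g) ->
  mu.-integrable `[a, b] (EFin \o (fun t => q.[t] * g t)).
Proof.
move=> ig; have [B hB] := horner_bounded q a b.
exact: (integrable_bounded_mul ig (@measurable_horner _ q) hB).
Qed.

Lemma Rintegral_poly a b g (e : nat -> R) k :
  mu.-integrable `[a, b] (EFin \o g) ->
  \int[mu]_(t in `[a, b]) ((\poly_(i < k) e i).[t] * g t) =
    \sum_(i < k) e i * moment a b g i.
Proof.
move=> ig; elim: k => [|k IH].
  rewrite big_ord0 poly_def big_ord0; under eq_Rintegral do rewrite horner0 mul0r.
  by rewrite Rintegral_cst// mul0r.
rewrite big_ord_recr/= -IH -RintegralZl//; last first.
  have := integrable_horner_mul 'X^k ig.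
  by apply: eq_integrable => // t _ /=; rewrite hornerXn.
rewrite -RintegralD//; last 2 first.
- exact: integrable_horner_mul.
- have := integrable_horner_mul (e k *: 'X^k) ig.
  by apply: eq_integrable => // t _ /=; rewrite hornerZ hornerXn mulrA.
apply: eq_Rintegral => t _.
by rewrite !poly_def big_ord_recr/= hornerD hornerZ hornerXn mulrDl mulrA.
Qed.

Lemma Rintegral_horner a b g q : mu.-integrable `[a, b] (EFin \o g) ->
  \int[mu]_(t in `[a, b]) (q.[t] * g t) = \sum_(i < size q) q`_i * moment a b g i.
Proof. by move=> ig; rewrite -[in LHS](coefK q) Rintegral_poly. Qed.

Lemma lebesgue_itvcc a b : a <= b -> mu `[a, b] = (b - a)%:E.
Proof.
rewrite le_eqVlt => /predU1P[->|ab]; apply: etrans (lebesgue_measure_itv _) _ => /=.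
  by rewrite ltxx subrr.
by rewrite lte_fin ab EFinB.
Qed.

Lemma integrable_cst_itv a b c : mu.-integrable `[a, b] (EFin \o (cst c : R -> R)).
Proof.
apply: continuous_compact_integrable; first exact: segment_compact.
by move=> ?; exact: cvg_cst.
Qed.

Lemma Rintegral_cst_itv a b c : a <= b -> \int[mu]_(t in `[a, b]) c = c * (b - a).
Proof.
move=> ab; rewrite Rintegral_cst//; congr (_ * _).
by rewrite -[RHS]/(fine (b - a)%:E); congr fine; exact: lebesgue_itvcc.
Qed.

Lemma Rintegral_norm_le a b h B : a <= b -> mu.-integrable `[a, b] (EFin \o h) ->
  (forall t, a <= t <= b -> `|h t| <= B) ->
  `|\int[mu]_(t in `[a, b]) h t| <= B * (b - a).
Proof.
move=> ab ih hB; rewrite -Rintegral_cst_itv//.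
apply: le_trans (le_normr_Rintegral _ ih) _ => //.
have ih' := integrable_norm ih; have ic := integrable_cst_itv a b B.
exact: le_Rintegral.
Qed.

Lemma nodes_le (p : nat) (x : nat -> R) k l :
  (forall i, (i <= p)%N -> x i < x i.+1) -> (k <= l <= p.+1)%N -> x k <= x l.
Proof.
move=> xinc; elim: l => [|l IH]; first by rewrite leqn0 => /andP[/eqP->].
move=> /andP[]; rewrite leq_eqVlt => /predU1P[->//|kl lp].
by rewrite (le_trans (IH _)) ?(ltW (xinc _ _))// -ltnS kl ltnW.
Qed.

Lemma Rintegral_sum_itv (p : nat) (x : nat -> R) h :
  (forall i, (i <= p)%N -> x i < x i.+1) ->
  mu.-integrable `[x 0%N, x p.+1] (EFin \o h) ->
  (forall i, (i <= p)%N -> \int[mu]_(t in `[x i, x i.+1]) h t = 0) ->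
  \int[mu]_(t in `[x 0%N, x p.+1]) h t = 0.
Proof.
elim: p => [|p IH] xi ih i0; first exact: i0.
have x0 : x 0%N <= x p.+1 by apply: nodes_le xi _; rewrite leq0n ltnW.
have xp : x p.+1 < x p.+2 by apply: xi.
have split_int := Rintegral_itvB ih (x := x p.+1); rewrite !bnd_simp in split_int.
move/(_ x0 (ltW xp)): split_int => /eqP; rewrite subr_eq => /eqP ->.
rewrite IH ?addr0 => [|i ip||i ip]; last 3 first.
- by apply: xi; exact: leqW.
- by apply: integrableS ih => //; apply: subset_itvl; rewrite bnd_simp ltW.
- by apply: i0; exact: leqW.
rewrite Rintegral_itv_obnd_cbnd ?i0//.
by apply: integrableS ih => //; apply: subset_itvr; rewrite bnd_simp.
Qed.

End Moments.

(** * The recurrence for the moments *)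

Section MomentRecurrence.
Context {R : realType}.
Notation mu := (@lebesgue_measure R).
Implicit Types (u : {poly R}) (v : {poly R[i]}).

Definition Re_poly := map_poly (@complex.Re R).
Definition Im_poly := map_poly (@complex.Im R).
Notation toC := (map_poly (real_complex R)).

Lemma coef_Re_poly v k : (Re_poly v)`_k = complex.Re v`_k.
Proof. by rewrite coef_map_id0. Qed.

Lemma coef_Im_poly v k : (Im_poly v)`_k = complex.Im v`_k.
Proof. by rewrite coef_map_id0. Qed.

Lemma Re_polyD v w : Re_poly (v + w) = Re_poly v + Re_poly w.
Proof. by apply/polyP => k; rewrite coefD !coef_Re_poly coefD ReD. Qed.

Lemma Im_polyD v w : Im_poly (v + w) = Im_poly v + Im_poly w.
Proof. by apply/polyP => k; rewrite coefD !coef_Im_poly coefD ImD. Qed.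

Lemma coef_mul_toC v u k : (v * toC u)`_k = \sum_(i < k.+1) v`_i * (u`_(k - i))%:C.
Proof. by rewrite coefM; apply: eq_bigr => i _; rewrite coef_map. Qed.

(** For real u, each coefficient of the adjoint is a combination of the coefficients of
    the p_j with real factors. *)
Lemma Re_adjoint n P u :
  Re_poly (adjoint n P (toC u)) = adjoint n (fun j => Re_poly (P j)) u.
Proof.
rewrite /adjoint (big_morph _ Re_polyD (map_poly0 _)); apply: eq_bigr => j _.
apply/polyP => k; rewrite coef_Re_poly !coefZ !coef_derivn coef_mul_toC coefM.
rewrite -[(-1) ^+ j in LHS](rmorph_sign (real_complex R)) mulrC ReMr mulrC.
congr (_ * _).
rewrite -[LHS]/(complex.Re _) -mulr_natr -(rmorph_nat (real_complex R)) ReMr.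
rewrite mulr_natr; congr (_ *+ _).
rewrite Re_sum.
by apply: eq_bigr => i _; rewrite ReMr coef_Re_poly.
Qed.

Lemma Im_adjoint n P u :
  Im_poly (adjoint n P (toC u)) = adjoint n (fun j => Im_poly (P j)) u.
Proof.
rewrite /adjoint (big_morph _ Im_polyD (map_poly0 _)); apply: eq_bigr => j _.
apply/polyP => k; rewrite coef_Im_poly !coefZ !coef_derivn coef_mul_toC coefM.
rewrite -[(-1) ^+ j in LHS](rmorph_sign (real_complex R)) mulrC ImMr mulrC.
congr (_ * _).
rewrite -[LHS]/(complex.Im _) -mulr_natr -(rmorph_nat (real_complex R)) ImMr.
rewrite mulr_natr; congr (_ *+ _).
rewrite Im_sum.
by apply: eq_bigr => i _; rewrite ImMr coef_Im_poly.
Qed.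

Lemma dnbhs_at_right (t : R) (S : set R) :
  (\forall s \near t^', S s) -> \forall s \near t^'+, S s.
Proof.
move=> h; apply: (filterS _ (h : nbhs t (fun s => s != t -> S s))).
by move=> s Ss ts; apply: Ss; rewrite gt_eqF.
Qed.

Lemma dnbhs_at_left (t : R) (S : set R) :
  (\forall s \near t^', S s) -> \forall s \near t^'-, S s.
Proof.
move=> h; apply: (filterS _ (h : nbhs t (fun s => s != t -> S s))).
by move=> s Ss ts; apply: Ss; rewrite lt_eqF.
Qed.

Section PiecewiseSolution.
Variables (a b : R) (n : nat) (P : nat -> {poly R[i]}).
Variables (p : nat) (x : nat -> R) (g : R -> R).
Hypotheses (Pn : P n != 0) (hg : class_PD a b n P p x g) (hF : fuchsian n P).

(** g being real, it is annihilated by the operators whose coefficients are the real, or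
    the imaginary, parts of the p_j. The estimates near the nodes however come from the
    complex equation, because neither of these two operators need be Fuchsian. *)
Lemma class_PD_integral_adjoint u (part : R[i] -> R) :
  part = @complex.Re R \/ part = @complex.Im R ->
  (forall i, (i <= p.+1)%N -> ('X - (x i)%:P) ^+ n %| u) ->
  \int[mu]_(t in `[a, b]) ((adjoint n (fun j => map_poly part (P j)) u).[t] * g t) = 0.
Proof.
move=> partE udvd; have [[xa xb] xinc [[M gM] ig] _ hode] := hg.
pose Q := fun j => map_poly part (P j).
have Q0 t : \sum_(j < n.+1) (P j).[t%:C] * (derive1n j g t)%:C = 0 ->
    \sum_(j < n.+1) (Q j).[t] * derive1n j g t = 0.
  case: partE => pE; rewrite /Q pE.
    move=> /(congr1 (@complex.Re R)); rewrite Re_sum.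
    by move=> h; rewrite -[RHS]h; apply: eq_bigr => j _; rewrite ReMr Re_horner.
  move=> /(congr1 (@complex.Im R)); rewrite Im_sum.
  by move=> h; rewrite -[RHS]h; apply: eq_bigr => j _; rewrite ImMr Im_horner.
have xmono k l : (k <= l <= p.+1)%N -> x k <= x l by exact: nodes_le.
have iint := integrable_horner_mul (adjoint n Q u) ig.
rewrite -xa -xb in iint *.
apply: Rintegral_sum_itv => // i ip.
have [xi0 xi1] : a <= x i /\ x i.+1 <= b.
  by rewrite -xa -xb !xmono//; apply/andP; split=> //; exact: leqW.
have [gcont godes] := hode i ip.
have der t j : x i < t < x i.+1 -> (j < n)%N ->
    is_derive t 1 (derive1n j g) (derive1n j.+1 g t).
  move=> ti jn; have tI : `]x i, x i.+1[%classic t by rewrite /= in_itv.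
  have [h _] := godes t tI.
  by apply: is_derive_eq; [exact: derivableP (h j jn)|rewrite [RHS]derive1E].
have ode t : x i < t < x i.+1 -> \sum_(j < n.+1) (P j).[t%:C] * (derive1n j g t)%:C = 0.
  by move=> ti; have [|_ //] := godes t _; rewrite /= in_itv.
have g_bound t : x i < t < x i.+1 -> `|derive1n 0 g t| <= M.
  move=> /andP[t1 t2]; apply: gM.
  by rewrite (le_trans xi0 (ltW t1)) (le_trans (ltW t2) xi1).
have [Cl Cl0 hl] := fuchs_inequality_near (x i) Pn hF.1.
have [Cr Cr0 hr] := fuchs_inequality_near (x i.+1) Pn hF.1.
have xii := xinc i ip.
have [Al hAl] : exists A, \forall t \near (x i)^'+, forall j, (j < n)%N ->
    `|t - x i| ^+ j * `|derive1n j g t| <= A.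
  apply: (@right_endpoint_bound _ n (fun j => derive1n j g) Cl (x i) (x i.+1) M) => //.
  near=> t; have : (forall D : nat -> R -> R,
    \sum_(j < n.+1) (P j).[t%:C] * (D j t)%:C = 0 ->
    fuchs_inequality n D Cl (x i) t).
    by near: t; apply: dnbhs_at_right.
  move=> /(_ (fun j => derive1n j g)); apply; apply: ode; apply/andP; split.
    by near: t; exact: nbhs_right_gt.
  by near: t; exact: nbhs_right_lt.
have [Ar hAr] : exists A, \forall t \near (x i.+1)^'-, forall j, (j < n)%N ->
    `|t - x i.+1| ^+ j * `|derive1n j g t| <= A.
  apply: (@left_endpoint_bound _ n (fun j => derive1n j g) Cr (x i) (x i.+1) M) => //.
  near=> t; have : (forall D : nat -> R -> R,
    \sum_(j < n.+1) (P j).[t%:C] * (D j t)%:C = 0 ->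
    fuchs_inequality n D Cr (x i.+1) t).
    by near: t; apply: dnbhs_at_left.
  move=> /(_ (fun j => derive1n j g)); apply; apply: ode; apply/andP; split.
    by near: t; exact: nbhs_left_gt.
  by near: t; exact: nbhs_left_lt.
apply: (@integral_adjoint_eq0 _ n Q (fun j => derive1n j g) u _ _ Al Ar) => //.
- by move=> t /ode/Q0.
- exact/udvd/leqW.
- exact: udvd.
- apply: integrableS iint => //; apply: subset_itv; rewrite bnd_simp.
    by apply: xmono; rewrite leq0n/= leqW.
  by apply: xmono; rewrite ltnS ip/=.
Unshelve. all: by end_near. Qed.

(** The relation given by u = w^n X^(k - tau), monic of degree k. The complex leading
    coefficient is nonzero, so its real or its imaginary part is, and the
    corresponding relation determines the moment. *)
Lemma moment_recurrence k : (n * (p + 2) <= k)%N ->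
  (forall j, (j < k + (size (P n)).-1 - n)%N -> moment a b g j = 0) ->
  indicial_infty n P k%:R != 0 -> moment a b g (k + (size (P n)).-1 - n) = 0.
Proof.
move=> tk low qk; set N := (k + _ - n)%N.
pose w : {poly R} := \prod_(i < p.+2) ('X - (x i)%:P).
pose u := w ^+ n * 'X^(k - n * (p + 2)).
have sw : size w = p.+3 by rewrite size_prod_XsubC /index_enum -enumT size_enum_ord.
have mw : w \is monic by apply: monic_prod_XsubC.
have mu : u \is monic by rewrite monicMr ?monicXn// monic_exp.
have su : size u = k.+1.
  rewrite size_Mmonic ?monicXn ?monic_neq0 ?monic_exp// size_polyXn addnS/=.
  have sE : (size (w ^+ n)).-1 = (n * (p + 2))%N by rewrite size_exp sw/= mulnC addn2.
  have := monic_neq0 (monic_exp n mw); rewrite -size_poly_gt0.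
  by move: (n * _)%N sE tk; move: (size _) => s1 s2; lia.
have udvd i : (i <= p.+1)%N -> ('X - (x i)%:P) ^+ n %| u.
  move=> ip; rewrite dvdp_mulr// dvdp_exp2r//.
  by rewrite /w (bigD1 (inord i))//= inordK// dvdp_mulr.
pose A := adjoint n P (toC u).
have nk : (n <= k)%N by rewrite (leq_trans _ tk)// leq_pmulr// addn2.
have sU : (size (toC u) <= k.+1)%N by rewrite size_map_poly su.
have sA : (size A <= N.+1)%N by apply: size_adjoint.
have AN : A`_N != 0.
  rewrite /A coef_adjoint_top// coef_map.
  have := mu; rewrite monicE lead_coefE su => /eqP->.
  by rewrite [X in _ * X](_ : _ = 1)// mulr1.
have part0 (part : R[i] -> R) : part 0 = 0 ->
    map_poly part A = adjoint n (fun j => map_poly part (P j)) u ->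
    part = @complex.Re R \/ part = @complex.Im R -> part A`_N * moment a b g N = 0.
  move=> p0 partA partE.
  have [_ _ [_ ig] _ _] := hg.
  have := class_PD_integral_adjoint partE udvd.
  rewrite -partA Rintegral_horner// => sum0.
  (* The size of the real polynomial is N.+1 only if its top coefficient survives. *)
  have [AN0|AN0] := eqVneq (part A`_N) 0; first by rewrite AN0 mul0r.
  have sPA : size (map_poly part A) = N.+1.
    apply/eqP; rewrite eqn_leq (leq_trans (size_poly _ _) sA)/= ltnNge.
    by apply: contra AN0 => /(nth_default 0); rewrite coef_map_id0// => ->.
  move: sum0; rewrite sPA big_ord_recr/= big1 => [|j _]; last by rewrite low ?mulr0.
  by rewrite add0r coef_map_id0.
have [ReA0 ImA0] := (part0 _ erefl (Re_adjoint n P u) (or_introl erefl),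
                     part0 _ erefl (Im_adjoint n P u) (or_intror erefl)).
apply/eqP; apply: contraNT AN => mN.
move/eqP: ReA0; move/eqP: ImA0; rewrite !mulf_eq0 (negbTE mN) !orbF.
by case: (A`_N) => re im /= /eqP-> /eqP->.
Qed.

Lemma moments_eq0 N :
  (maxn (n * (p + 2)).-1 (Lambda n P))%:Z + (size (P n)).-1%:Z - n%:Z <= N%:Z ->
  (forall j, (j <= N)%N -> moment a b g j = 0) -> forall j, moment a b g j = 0.
Proof.
move=> hN low; elim/ltn_ind => j IH.
have [jN|Nj] := leqP j N; first exact: low.
have jE : (j = (j + n - (size (P n)).-1) + (size (P n)).-1 - n)%N.
  by move: hN Nj; move: (size _) => s; lia.
rewrite jE; apply: moment_recurrence.
- by move: hN Nj; move: (size _) => s; lia.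
- by rewrite -jE.
- apply: indicial_gt_Lambda => //.
  by move: hN Nj; move: (size _) (Lambda n P) => s l; lia.
Qed.

End PiecewiseSolution.
End MomentRecurrence.

(** * Growth of the moments *)

Section MomentGrowth.
Context {R : realType}.
Notation mu := (@lebesgue_measure R).
Implicit Types (q s : {poly R}) (C eps : R).

Lemma expr_eventually_lt (r e : R) : 0 <= r < 1 -> 0 < e ->
  exists K : nat, forall k, (K <= k)%N -> r ^+ k < e.
Proof.
move=> /andP[r0 r1] e0.
have /(@cvg_expr R) : `|r| < 1 by rewrite ger0_norm.
by move=> /cvgr_lt/(_ e e0)[K _ hK]; exists K => k; exact: hK.
Qed.

Section Functional.
Variables (a b : R) (g : R -> R).
Hypothesis ig : mu.-integrable `[a, b] (EFin \o g).

(** Multiplication by s expresses an integral as a combination of integrals with higher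
    powers of t; as eps <= 1 these satisfy the same bound, so each factor s costs the
    sum of the moduli of its coefficients. *)
Lemma moment_power_bound s C eps : 0 <= eps <= 1 ->
  (forall k, `|moment a b g k| <= C * eps ^+ k) ->
  forall k m, `|\int[mu]_(t in `[a, b]) (('X^m * s ^+ k).[t] * g t)| <=
     C * (\sum_(i < size s) `|s`_i|) ^+ k * eps ^+ m.
Proof.
move=> /andP[e0 e1] mC; set A := \sum_(i < _) _.
have C0 : 0 <= C by have := mC 0%N; rewrite expr0 mulr1; exact: le_trans.
elim=> [|k IH] m.
  rewrite expr0 !mulr1; apply: le_trans (mC m); rewrite le_eqVlt; apply/orP; left.
  by apply/eqP; congr `|_|; apply: eq_Rintegral => t _; rewrite hornerXn.
have -> : \int[mu]_(t in `[a, b]) (('X^m * s ^+ k.+1).[t] * g t) =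
    \sum_(i < size s) s`_i * \int[mu]_(t in `[a, b]) (('X^(m + i) * s ^+ k).[t] * g t).
  have step l :
    \int[mu]_(t in `[a, b]) (('X^m * s ^+ k * \poly_(i < l) s`_i).[t] * g t) =
    \sum_(i < l) s`_i * \int[mu]_(t in `[a, b]) (('X^(m + i) * s ^+ k).[t] * g t).
    elim: l => [|l IHl].
      rewrite big_ord0 poly_def big_ord0 mulr0.
      by under eq_Rintegral do rewrite horner0 mul0r; rewrite Rintegral_cst// mul0r.
    rewrite big_ord_recr/= -IHl -RintegralZl//; last exact: integrable_horner_mul.
    rewrite -RintegralD//; [|exact: integrable_horner_mul|]; last first.
      have := integrable_horner_mul (s`_l *: ('X^(m + l) * s ^+ k)) ig.
      by apply: eq_integrable => // t _ /=; rewrite hornerZ mulrA.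
    apply: eq_Rintegral => t _.
    rewrite !poly_def big_ord_recr/= mulrDr hornerD mulrDl; congr (_ + _).
    by rewrite !hornerM !hornerZ !hornerXn exprD; ring.
  by rewrite -step coefK exprSr mulrA.
apply: le_trans (ler_norm_sum _ _ _) _.
rewrite exprSr /A mulrA mulr_sumr mulr_suml; apply: ler_sum => i _.
rewrite normrM; apply: le_trans (ler_wpM2l (normr_ge0 _) (IH (m + i)%N)) _.
rewrite -/A exprD !mulrA [_ * `|s`_i|]mulrC !mulrA.
rewrite ler_piMr ?exprn_ile1// !mulr_ge0 ?exprn_ge0//.
by rewrite /A sumr_ge0.
Qed.

(** The factor t^2 vanishes at 0 and is comparable to a constant near t1 <> 0. It is
    multiplied by a power of 1 - e (t - t1)^2, which takes values in [1/2, 1] on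
    [a, b]; a large power makes the ratio of the values far from t1 and near t1
    as small as desired, whatever the size of t^2. *)
Lemma peak_weight (t1 delta : R) : t1 != 0 -> 0 < delta -> a < b ->
  a <= t1 <= b -> delta <= `|t1| -> delta <= b - a ->
  exists s (U L : R), [/\ 0 <= U, U < L,
    forall t, a <= t <= b -> 0 <= s.[t],
    forall t, a <= t <= b -> `|t - t1| <= delta / 2 -> L <= t ^+ 2 * s.[t] &
    forall t, a <= t <= b -> delta <= `|t - t1| -> t ^+ 2 * s.[t] <= U].
Proof.
move=> t10 d0 ab /andP[at1 t1b] dt1 dab.
pose e := (2 * (b - a) ^+ 2)^-1.
have ba0 : 0 < b - a by rewrite subr_gt0.
have e0 : 0 < e by rewrite invr_gt0 mulr_gt0// exprn_gt0.
pose w : {poly R} := 1 - e *: ('X - t1%:P) ^+ 2.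
have wE t : w.[t] = 1 - e * `|t - t1| ^+ 2.
  rewrite /w hornerD hornerN hornerZ horner_exp hornerXsubC hornerC.
  by rewrite real_normK ?num_real.
have eb : e * (b - a) ^+ 2 = 2^-1.
  by rewrite /e invfM mulrVK// unitfE expf_neq0// gt_eqF.
have dist t : a <= t <= b -> `|t - t1| <= b - a.
  by move=> /andP[ta tb]; rewrite ler_norml; apply/andP; split; lra.
have w_ge t : a <= t <= b -> 2^-1 <= w.[t].
  move=> tab; rewrite wE.
  have : e * `|t - t1| ^+ 2 <= 2^-1.
    by rewrite -eb ler_pM2l// lerXn2r ?nnegrE ?dist// ltW.
  by lra.
(* q1 bounds w from above far from t1, q2 bounds it from below near t1. *)
pose q1 := 1 - e * delta ^+ 2; pose q2 := 1 - e * (delta / 2) ^+ 2.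
have ed0 : 0 < e * delta ^+ 2 by rewrite mulr_gt0// exprn_gt0.
have q2E : q2 = 1 - e * delta ^+ 2 / 4 by rewrite /q2 expr_div_n; field.
have q12 : q1 < q2 by rewrite q2E /q1; lra.
have q10 : 2^-1 <= q1.
  rewrite /q1; have : e * delta ^+ 2 <= 2^-1.
    by rewrite -eb ler_pM2l// lerXn2r// nnegrE ltW.
  by lra.
have q1_gt0 : 0 < q1 by lra.
have q2_gt0 : 0 < q2 by lra.
pose c2 := a ^+ 2 + b ^+ 2 + 1.
have c20 : 0 < c2 by rewrite ltr_wpDl// addr_ge0// sqr_ge0.
have t1sq : 0 < t1 ^+ 2 / 4 by rewrite divr_gt0// lt0r sqrf_eq0 t10 sqr_ge0.
have [||l hl] := @expr_eventually_lt (q1 / q2) (t1 ^+ 2 / 4 / c2).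
- by rewrite divr_ge0 ?(ltW q1_gt0) ?(ltW q2_gt0)//= ltr_pdivrMr// mul1r.
- by rewrite divr_gt0.
have {}hl := hl l (leqnn l).
have sqc t : a <= t <= b -> t ^+ 2 <= c2.
  move=> /andP[ta tb]; rewrite /c2; have [t0|t0] := leP 0 t.
    have : t ^+ 2 <= b ^+ 2 by rewrite lerXn2r// nnegrE (le_trans t0).
    by have := sqr_ge0 a; lra.
  have : (- t) ^+ 2 <= (- a) ^+ 2 by rewrite lerXn2r ?nnegrE ?lerN2//; lra.
  by rewrite !sqrrN; have := sqr_ge0 b; lra.
exists (w ^+ l), (c2 * q1 ^+ l), (t1 ^+ 2 / 4 * q2 ^+ l); split.
- by rewrite mulr_ge0 ?exprn_ge0// ltW.
- move: hl; rewrite expr_div_n ltr_pdivrMr ?exprn_gt0// => hl.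
  by rewrite mulrC -ltr_pdivlMr// mulrAC.
- by move=> t tab; rewrite horner_exp exprn_ge0// (le_trans _ (w_ge t tab)).
- move=> t tab td; rewrite horner_exp.
  have tt1 : `|t1| / 2 <= `|t|.
    have := lerB_dist t1 t; rewrite distrC => h.
    have : `|t1 - t| <= delta / 2 by rewrite distrC.
    by rewrite distrC in h; lra.
  apply: ler_pM; rewrite ?exprn_ge0 ?(ltW t1sq) ?(ltW q2_gt0)//.
    have -> : t1 ^+ 2 / 4 = (`|t1| / 2) ^+ 2.
      by rewrite expr_div_n real_normK ?num_real//; congr (_ / _); ring.
    by rewrite -[t ^+ 2]real_normK ?num_real// lerXn2r ?nnegrE// divr_ge0.
  have wq : q2 <= w.[t].
    by rewrite wE /q2 lerB// ler_pM2l// lerXn2r// nnegrE divr_ge0// ltW.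
  by rewrite lerXn2r// nnegrE (le_trans (ltW q2_gt0)).
- move=> t tab td; rewrite horner_exp.
  have wt : 0 <= w.[t] by apply: le_trans (w_ge t tab).
  have wq : w.[t] <= q1.
    by rewrite wE /q1 lerB// ler_pM2l// lerXn2r// nnegrE ltW.
  by apply: ler_pM; rewrite ?sqr_ge0 ?exprn_ge0 ?sqc// lerXn2r// nnegrE ltW.
Qed.

End Functional.
End MomentGrowth.

Section MomentGrowthRate.
Context {R : realType}.
Notation mu := (@lebesgue_measure R).
Variables (a b : R) (g : R -> R) (M : R).
Hypotheses (ab : a < b) (ig : mu.-integrable `[a, b] (EFin \o g)).
Hypothesis gM : forall t, a <= t <= b -> `|g t| <= M.

(** Let u = X^2 s be the peaked weight. If |m_k| <= C eps^k for all k, then the integral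
    of u^k g is at most C (A eps^2)^k <= C (L / 2)^k, while it is at least
    eta delta L^k - M (b - a) U^k with U < L: near t1 the function g is at least eta,
    and far from t1 the weight is at most U. For large k this is a contradiction. *)
Lemma moment_growth_pos (t1 delta eta : R) : t1 != 0 -> 0 < delta -> 0 < eta ->
  a <= t1 - delta -> t1 + delta <= b -> delta <= `|t1| ->
  (forall t, `|t - t1| <= delta -> eta <= g t) ->
  exists2 eps : R, 0 < eps &
    forall C, exists k, C * eps ^+ k < `|moment a b g k|.
Proof.
move=> t10 d0 eta0 at1 t1b dt1 geta.
have t1ab : a <= t1 <= b by apply/andP; split; lra.
have dab : delta <= b - a by lra.
have [s [U [L [U0 UL s0 peak off]]]] := peak_weight t10 d0 ab t1ab dt1 dab.
have L0 : 0 < L by exact: le_lt_trans UL.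
pose A := \sum_(i < size s) `|s`_i|; have A0 : 0 <= A by rewrite sumr_ge0.
(* This choice gives eps <= 1 and A eps^2 <= L / 2. *)
pose eps := Num.min 1 (L / (2 * (A + 1))).
have A1 : 0 < 2 * (A + 1) by rewrite mulr_gt0// ltr_wpDl.
have eps0 : 0 < eps by rewrite lt_min ltr01 divr_gt0.
have eps1 : eps <= 1 by rewrite ge_min lexx.
have epsL : A * eps ^+ 2 <= L / 2.
  have : eps <= L / (2 * (A + 1)) by rewrite ge_min lexx orbT.
  rewrite ler_pdivlMr// => h.
  have : A * eps ^+ 2 <= A * eps.
    by rewrite expr2 ler_wpM2l// ler_piMl// ltW.
  by have := ltW eps0; lra.
exists eps => // C; apply/not_existsP => no.
have mC k : `|moment a b g k| <= C * eps ^+ k by rewrite leNgt; apply/negP/no.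
have C0 : 0 <= C by have := mC 0%N; rewrite expr0 mulr1; exact: le_trans.
have aab : a <= a <= b by rewrite lexx ltW.
have M0 : 0 <= M by exact: le_trans (normr_ge0 _) (gM aab).
have upper k :
    `|\int[mu]_(t in `[a, b]) ((('X^2 * s) ^+ k).[t] * g t)| <= C * (L / 2) ^+ k.
  rewrite exprMn -exprM; have := moment_power_bound ig s _ mC k (2 * k).
  rewrite (ltW eps0) eps1 => /(_ isT)/le_trans; apply.
  rewrite -/A exprM -mulrA -exprMn ler_wpM2l// lerXn2r// nnegrE.
    by rewrite mulr_ge0// exprn_ge0// ltW.
  by rewrite divr_ge0// ltW.
pose J : set (measurableTypeR R) := `[t1 - delta / 2, t1 + delta / 2]%classic.
have Jsub : J `<=` `[a, b] by apply: subset_itv; rewrite bnd_simp; lra.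
have iJ : mu.-integrable `[a, b] (EFin \o (\1_J : R -> R)).
  apply: integrableS (integrable_indic_itv _ _ _ _) => //.
have Jint : \int[mu]_(t in `[a, b]) (\1_J t : R) = delta.
  have mJ : measurable J by exact: measurable_itv.
  have muJ : mu J = delta%:E.
    by apply: etrans (lebesgue_itvcc _) _; [lra|congr EFin; field].
  have muJ' : (\int[mu]_(t in `[a, b]) (\1_J t)%:E = delta%:E)%E.
    by rewrite (integral_indic _ _ mJ)// -muJ; congr (mu _); exact: setIidl.
  by rewrite /Rintegral muJ'.
have iJc c : mu.-integrable `[a, b] (EFin \o (fun t => c * (\1_J : R -> R) t)).
  apply: (integrable_bounded_mul (h := cst c) (B := `|c|) iJ) => //.
have lower k : eta * delta * L ^+ k - M * (b - a) * U ^+ k <=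
    \int[mu]_(t in `[a, b]) ((('X^2 * s) ^+ k).[t] * g t).
  have -> : eta * delta * L ^+ k - M * (b - a) * U ^+ k =
      \int[mu]_(t in `[a, b]) (eta * L ^+ k * \1_J t - M * U ^+ k).
    have I1 c : \int[mu]_(t in `[a, b]) (c * \1_J t) = c * delta.
      by rewrite -[in RHS]Jint; exact: RintegralZl.
    transitivity (\int[mu]_(t in `[a, b]) (eta * L ^+ k * \1_J t) -
                  \int[mu]_(t in `[a, b]) (M * U ^+ k)).
      by rewrite I1 Rintegral_cst_itv ?ltW//; ring.
    by apply/esym/RintegralB => //; exact: integrable_cst_itv.
  have mD : measurable (`[a, b]%classic : set (measurableTypeR R)) by [].
  have iB := integrableB mD (iJc (eta * L ^+ k)) (integrable_cst_itv a b (M * U ^+ k)).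
  apply: le_Rintegral => //; first exact: integrable_horner_mul.
  move=> t /=; rewrite in_itv/= => tab; rewrite horner_exp hornerM hornerXn.
  have u0 : 0 <= t ^+ 2 * s.[t] by rewrite mulr_ge0 ?sqr_ge0 ?s0.
  have MU0 : 0 <= M * U ^+ k by rewrite mulr_ge0// exprn_ge0.
  have etaL : 0 <= eta * L ^+ k by rewrite mulr_ge0 ?exprn_ge0 ?ltW.
  have [far|near] := leP delta `|t - t1|.
    have tJ : (t \in J) = false.
      apply/negbTE/negP; rewrite inE /J/= in_itv/= => /andP[t2 t3].
      have : `|t - t1| <= delta / 2 by rewrite ler_norml; apply/andP; split; lra.
      by lra.
    rewrite indicE tJ mulr0 sub0r.
    have := off t tab far => uU.
    have : `|(t ^+ 2 * s.[t]) ^+ k * g t| <= U ^+ k * M.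
      rewrite normrM ler_pM// ?gM// ger0_norm ?exprn_ge0// lerXn2r// nnegrE.
    by rewrite ler_norml => /andP[+ _]; rewrite mulrC.
  have gt : eta <= g t by rewrite geta// ltW.
  have gk0 : 0 <= (t ^+ 2 * s.[t]) ^+ k * g t.
    by rewrite mulr_ge0 ?exprn_ge0// (le_trans (ltW eta0)).
  have [close|nclose] := boolP (t \in J); rewrite indicE.
    rewrite close mulr1 mulrC lerBlDr.
    apply: (@le_trans _ _ ((t ^+ 2 * s.[t]) ^+ k * g t)).
      apply: ler_pM; rewrite ?exprn_ge0 ?(ltW L0) ?(ltW eta0)//.
      rewrite lerXn2r ?nnegrE ?(ltW L0)//; apply: peak => //.
      move: close; rewrite inE /J/= in_itv/= => /andP[t2 t3].
      by rewrite ler_norml; apply/andP; split; lra.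
    by rewrite lerDl.
  by rewrite (negbTE nclose) mulr0 sub0r (le_trans _ gk0)// oppr_le0.
have {}lower k : eta * delta * L ^+ k <= M * (b - a) * U ^+ k + C * (L / 2) ^+ k.
  by rewrite -lerBlDl (le_trans (lower k))// (le_trans (ler_norm _)).
pose e1 := eta * delta / (2 * (M * (b - a) + 1)).
pose e2 := eta * delta / (2 * (C + 1)).
have ed0 : 0 < eta * delta by rewrite mulr_gt0.
have ba0 : 0 <= b - a by rewrite subr_ge0 ltW.
have m1 : 0 < 2 * (M * (b - a) + 1) by rewrite mulr_gt0// ltr_wpDl// mulr_ge0.
have m2 : 0 < 2 * (C + 1) by rewrite mulr_gt0// ltr_wpDl.
have [||K1 h1] := @expr_eventually_lt R (U / L) e1.
- by rewrite divr_ge0 ?(ltW L0)//= ltr_pdivrMr// mul1r.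
- by rewrite divr_gt0.
have [||K2 h2] := @expr_eventually_lt R 2^-1 e2.
- by rewrite invr_ge0 ler0n/= invf_lt1// ltr1n.
- by rewrite divr_gt0.
pose k := maxn K1 K2.
have {}h1 := h1 k (leq_maxl _ _); have {}h2 := h2 k (leq_maxr _ _).
have Lk : 0 < L ^+ k by rewrite exprn_gt0.
have := lower k; apply/negP; rewrite -ltNge.
have -> : M * (b - a) * U ^+ k + C * (L / 2) ^+ k =
    (M * (b - a) * (U / L) ^+ k + C * 2^-1 ^+ k) * L ^+ k.
  rewrite !expr_div_n exprVn mulrDl; congr (_ + _).
    by rewrite -!mulrA mulVf ?mulr1// gt_eqF.
  by rewrite -!mulrA; congr (_ * _); rewrite mulrC.
rewrite ltr_pM2r//.
have b1 : M * (b - a) * (U / L) ^+ k <= M * (b - a) * e1.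
  by rewrite ler_wpM2l ?mulr_ge0// ltW.
have b2 : C * 2^-1 ^+ k <= C * e2 by rewrite ler_wpM2l// ltW.
have b3 : (M * (b - a) + 1) * e1 = eta * delta / 2.
  by rewrite /e1; field; rewrite gt_eqF// ltr_wpDl// mulr_ge0.
have b4 : (C + 1) * e2 = eta * delta / 2.
  by rewrite /e2; field; rewrite gt_eqF// ltr_wpDl.
have e10 : 0 < e1 by rewrite divr_gt0.
apply: (le_lt_trans (lerD b1 b2)); rewrite (splitr (eta * delta)) -{1}b3 -b4.
rewrite ltr_leD// ?ltr_pM2r ?ler_pM2r ?ltrDl ?lerDl ?divr_gt0//.
Qed.
End MomentGrowthRate.

Section MomentGrowthGeneral.
Context {R : realType}.
Notation mu := (@lebesgue_measure R).

(** Up to the sign of g, continuity gives an interval around t0 where g stays above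
    g t0 / 2; its centre is moved to t1 <> 0 in the case t0 = 0. *)
Lemma moment_growth (a b : R) (g : R -> R) (M t0 : R) :
  mu.-integrable `[a, b] (EFin \o g) ->
  (forall t, a <= t <= b -> `|g t| <= M) ->
  a < t0 < b -> {for t0, continuous g} -> g t0 != 0 ->
  exists2 eps : R, 0 < eps &
    forall C, exists k, C * eps ^+ k < `|moment a b g k|.
Proof.
move=> ig gM /andP[at0 t0b] cg g0.
wlog gpos : g ig gM cg g0 / 0 < g t0.
  move=> main.
  have [gpos|gneg|g00] := ltgtP 0 (g t0); last by move: g0; rewrite -g00 eqxx.
    exact: main gpos.
  have [|||||eps eps0 h] := main (\- g).
  - have := integrable_horner_mul (-1)%:P ig.
    by apply: eq_integrable => // t _ /=; rewrite hornerC mulN1r.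
  - by move=> t tab /=; rewrite normrN gM.
  - exact: continuousN.
  - by rewrite /= oppr_eq0.
  - by rewrite /= oppr_gt0.
  exists eps => // C; have [k hk] := h C; exists k; rewrite (lt_le_trans hk)//.
  rewrite /moment; under eq_Rintegral do rewrite /= mulrN -mulN1r.
  rewrite RintegralZl ?mulN1r ?normrN//.
  have := integrable_horner_mul 'X^k ig.
  by apply: eq_integrable => // t _ /=; rewrite hornerXn.
have [r /= r0 hr] : exists2 r : R, 0 < r & forall t, `|t - t0| < r -> g t0 / 2 < g t.
  have : \forall t \near t0, g t0 / 2 < g t.
    by move: cg => /cvgr_gt; apply; rewrite ltr_pdivrMr// ltr_pMr// ltr1n.
  by move=> [r /= r0 hr]; exists r => // t tr; apply: hr; rewrite /= distrC.
pose r' := Num.min r (Num.min (t0 - a) (b - t0)).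
have r'0 : 0 < r' by rewrite !lt_min r0 !subr_gt0 at0.
have [r'r r'a r'b] : [/\ r' <= r, r' <= t0 - a & r' <= b - t0].
  by rewrite /r' !ge_min !lexx/= !orbT.
pose t1 := if t0 == 0 then r' / 2 else t0.
have t10 : t1 != 0 by rewrite /t1; case: ifPn => // _; rewrite gt_eqF// divr_gt0.
have t1t0 : `|t1 - t0| <= r' / 2.
  rewrite /t1; case: ifPn => [/eqP->|_]; last by rewrite subrr normr0 divr_ge0// ltW.
  by rewrite subr0 ger0_norm// divr_ge0// ltW.
pose delta := Num.min (r' / 4) `|t1|.
have d0 : 0 < delta by rewrite lt_min divr_gt0//= normr_gt0.
have [dr dt1] : delta <= r' / 4 /\ delta <= `|t1| by rewrite !ge_min !lexx orbT.
have geta t : `|t - t1| <= delta -> g t0 / 2 <= g t.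
  move=> tt1; apply/ltW/hr; have := ler_distD t1 t t0; lra.
have [d1 d2] : t1 - t0 <= r' / 2 /\ - (r' / 2) <= t1 - t0.
  by move: t1t0; rewrite ler_norml => /andP[].
have ab : a < b by exact: lt_trans t0b.
have eta0 : 0 < g t0 / 2 by rewrite divr_gt0.
apply: (moment_growth_pos ab ig gM t10 d0 eta0 _ _ dt1 geta); lra.
Qed.

End MomentGrowthGeneral.

(** * Complex power series *)

Section ComplexSeries.
Context {R : realType}.
Implicit Types (c : nat -> R[i]) (z s : R[i]).

Lemma normcR z : `|z| = (cmod z)%:C.
Proof. by []. Qed.

Lemma power_series_sumP c z s : power_series_sum c z s <->
  forall e : R[i], 0 < e ->
    \forall n \near \oo, `|s - series (fun k => c k * z ^+ k) n| < e.
Proof.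
exact: (@pseudometric_normed_Zmodule.cvgrPdist_lt
  (R[i] : numFieldType) (R[i] : numFieldType)).
Qed.

Lemma power_series_sum_geometric c z s (B q : R) : 0 <= q < 1 ->
  (forall n, cmod (s - \sum_(k < n) c k * z ^+ k) <= B * q ^+ n) ->
  power_series_sum c z s.
Proof.
move=> q01 bound; apply/power_series_sumP => e e0.
have eE : e = (complex.Re e)%:C.
  by move: e0; case: e => x y; rewrite ltcE /= => /andP[/eqP-> _].
have re0 : 0 < complex.Re e by move: e0; rewrite ltcE => /andP[].
have B0 : 0 <= B.
  by have := bound 0%N; rewrite expr0 mulr1; apply: le_trans; exact: cmod_ge0.
have B1 : 0 < B + 1 by rewrite ltr_wpDl.
have [|K hK] := expr_eventually_lt q01 (e := complex.Re e / (B + 1)).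
  by rewrite divr_gt0.
near=> n; rewrite normcR eE ltcR /series/= big_mkord.
apply: le_lt_trans (bound n) _.
have : q ^+ n < complex.Re e / (B + 1) by apply: hK; near: n; exact: nbhs_infty_ge.
rewrite ltr_pdivlMr//; apply: le_lt_trans.
by rewrite mulrC ler_wpM2l ?lerDl// exprn_ge0//; case/andP: q01.
Unshelve. all: by end_near. Qed.

(** The terms of a convergent series are differences of consecutive partial sums. *)
Lemma power_series_sum_bounded c z s : power_series_sum c z s ->
  exists C : R, forall k, cmod (c k) * cmod z ^+ k <= C.
Proof.
move=> /power_series_sumP/(_ 1 ltr01)[K _ hK].
have tail k : (K <= k)%N -> cmod (c k) * cmod z ^+ k <= 2.
  move=> Kk; have := hK k Kk; have := hK k.+1 (leqW Kk).
  rewrite /= !normcR !(ltcR _ 1) => h1 h2.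
  rewrite -cmodX -cmodM.
  have -> : c k * z ^+ k = (s - series (fun k => c k * z ^+ k) k) -
      (s - series (fun k => c k * z ^+ k) k.+1).
    by rewrite /series/= big_nat_recr//=; ring.
  apply: le_trans (le_normcD _ _) _; rewrite normcN; lra.
exists (2 + \sum_(k < K) cmod (c k) * cmod z ^+ k) => k.
have pos j : 0 <= cmod (c j) * cmod z ^+ j by rewrite mulr_ge0 ?exprn_ge0 ?cmod_ge0.
have [Kk|kK] := leqP K k; first by rewrite (le_trans (tail k Kk))// lerDl sumr_ge0.
by rewrite (bigD1 (Ordinal kK))//= addrCA lerDl addr_ge0// sumr_ge0.
Qed.

Lemma convergence_radius_ge c z s : power_series_sum c z s ->
  ((cmod z)%:E <= convergence_radius c)%E.
Proof. by move=> h; apply: ereal_sup_ubound; exists z => //; exists s. Qed.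

Lemma limn_esup_le1 (u : nat -> \bar R) :
  (forall e : R, 0 < e -> \forall k \near \oo, (u k <= (1 + e)%:E)%E) ->
  (limn_esup u <= 1)%E.
Proof.
move=> h; apply/lee_addgt0Pr => e e0; have [K _ hK] := h e e0.
apply: (@le_trans _ _ (ereal_sup [set u k | k in [set k | (K <= k)%N]])).
  by apply: ereal_inf_lbound; exists [set k | (K <= k)%N] => //; exists K.
by apply: ge_ereal_sup => _ [k /= Kk <-]; apply: hK.
Qed.

End ComplexSeries.

(** * Expansion of the Stieltjes transform *)

Section StieltjesExpansion.
Context {R : realType}.
Notation mu := (@lebesgue_measure R).
Variables (a b : R) (g : R -> R) (M c0 : R) (z : R[i]).
Hypotheses (ab : a <= b) (ig : mu.-integrable `[a, b] (EFin \o g)).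
Hypothesis gM : forall t, a <= t <= b -> `|g t| <= M.
Hypothesis tc0 : forall t, a <= t <= b -> `|t| <= c0.
Hypotheses (c00 : 0 <= c0) (zc0 : cmod z * c0 < 1).

Let q := cmod z * c0.
Let kernel (t : R) : R[i] := (1 - z * t%:C)^-1.

Lemma cmod_kernel_arg t : a <= t <= b -> cmod (z * t%:C) <= q.
Proof. by move=> /tc0 tc; rewrite cmodM cmodR ler_wpM2l ?cmod_ge0. Qed.

Lemma kernel_denominator t : a <= t <= b -> 1 - q <= cmod (1 - z * t%:C).
Proof.
move=> tab; have := le_normcD (1 - z * t%:C) (z * t%:C); rewrite subrK.
rewrite ComplexField.Normc.normc1; have := cmod_kernel_arg tab; lra.
Qed.

Lemma kernel_neq0 t : a <= t <= b -> 1 - z * t%:C != 0.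
Proof.
move=> /kernel_denominator h; rewrite -cmod_gt0; apply: lt_le_trans h.
by rewrite subr_gt0.
Qed.

Lemma geometric_remainder t k : a <= t <= b ->
  cmod (kernel t - \sum_(i < k) (z * t%:C) ^+ i) <= q ^+ k / (1 - q).
Proof.
move=> tab; have n0 := kernel_neq0 tab.
have -> : kernel t - \sum_(i < k) (z * t%:C) ^+ i = (z * t%:C) ^+ k * kernel t.
  have := subrX1 (z * t%:C) k => geo.
  apply: (mulIf n0); rewrite mulrBl -mulrA /kernel mulVf// mulr1.
  by rewrite mulrC -[X in 1 - X * _]opprB mulNr -geo; ring.
rewrite cmodM cmodX ler_pM ?exprn_ge0 ?cmod_ge0//.
  by rewrite lerXn2r ?nnegrE ?cmod_ge0 ?cmod_kernel_arg// mulr_ge0 ?cmod_ge0.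
rewrite ComplexField.Normc.normcV lef_pV2 ?posrE ?cmod_gt0 ?subr_gt0//.
exact: kernel_denominator.
Qed.

Section RealOrImaginaryPart.
Variable part : R[i] -> R.
Hypotheses (part0 : part 0 = 0)
  (partD : forall w1 w2, part (w1 + w2) = part w1 + part w2)
  (partM : forall w t, part (w * t%:C) = part w * t)
  (part_le : forall w, `|part w| <= cmod w)
  (part_kernel : measurable_fun (`[a, b]%classic : set (measurableTypeR R))
    (part \o kernel)).

(** With part = Re or part = Im: the corresponding part of a partial sum of the series is
    the integral of g against the real polynomial with coefficients part (z^i). *)
Lemma part_remainder k :
  `|\int[mu]_(t in `[a, b]) part ((g t)%:C / (1 - z * t%:C)) -
    \sum_(i < k) part (z ^+ i) * moment a b g i| <= M * (b - a) / (1 - q) * q ^+ k.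
Proof.
have partB w1 w2 : part (w1 - w2) = part w1 - part w2.
  have := partD (w1 - w2) w2; rewrite subrK => ->; by rewrite addrK.
have q1 : 0 < 1 - q by rewrite subr_gt0.
have iK : mu.-integrable `[a, b] (EFin \o (fun t => part (kernel t) * g t)).
  apply: (integrable_bounded_mul (B := (1 - q)^-1) ig part_kernel) => t tab.
  apply: le_trans (part_le _) _; rewrite ComplexField.Normc.normcV.
  by rewrite lef_pV2 ?posrE ?cmod_gt0 ?kernel_neq0 ?kernel_denominator.
rewrite -(Rintegral_poly (fun i => part (z ^+ i)))//.
pose qk := \poly_(i < k) part (z ^+ i).
have -> : \int[mu]_(t in `[a, b]) part ((g t)%:C / (1 - z * t%:C)) =
    \int[mu]_(t in `[a, b]) (part (kernel t) * g t).
  by apply: eq_Rintegral => t _; rewrite mulrC partM.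
rewrite -RintegralB//; last exact: integrable_horner_mul.
have -> : M * (b - a) / (1 - q) * q ^+ k = (q ^+ k / (1 - q) * M) * (b - a) by ring.
have mD : measurable (`[a, b]%classic : set (measurableTypeR R)) by [].
have iB := integrableB mD iK (integrable_horner_mul qk ig).
apply: Rintegral_norm_le => // t tab.
rewrite -mulrBl normrM; apply: ler_pM => //; last exact: gM.
apply: le_trans (geometric_remainder k tab); apply: le_trans (part_le _).
rewrite partB (big_morph _ partD part0) horner_poly.
by under [X in _ <= `|_ - X|]eq_bigr do rewrite exprMn -rmorphXn partM.
Qed.

End RealOrImaginaryPart.

Lemma Re_inv (w : R[i]) :
  complex.Re w^-1 = complex.Re w / (complex.Re w ^+ 2 + complex.Im w ^+ 2).
Proof. by case: w. Qed.

Lemma Im_inv (w : R[i]) :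
  complex.Im w^-1 = - complex.Im w / (complex.Re w ^+ 2 + complex.Im w ^+ 2).
Proof. by case: w => x y /=; rewrite mulNr. Qed.

Let pr : {poly R} := 1 - complex.Re z *: 'X.
Let pi : {poly R} := - (complex.Im z *: 'X).

Lemma kernel_arg_parts t : 1 - z * t%:C = pr.[t] +i* pi.[t].
Proof.
rewrite /pr /pi !hornerE; case: z => x y; simpc; congr (_ +i* _); ring.
Qed.

Lemma measurable_quotient (num : {poly R}) :
  measurable_fun (`[a, b]%classic : set (measurableTypeR R))
    (fun t => num.[t] / (pr.[t] ^+ 2 + pi.[t] ^+ 2)).
Proof.
have -> : (fun t => num.[t] / (pr.[t] ^+ 2 + pi.[t] ^+ 2)) =
    (fun t => num.[t] / (pr ^+ 2 + pi ^+ 2).[t]).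
  by apply/funext => t; rewrite [(pr ^+ 2 + _).[t]]hornerD !horner_exp.
apply: measurable_realfun.subspace_continuous_measurable_fun => //.
apply: continuous_in_subspaceT => t; rewrite inE/= in_itv/= => tab.
apply: cvgM; first exact: continuous_horner.
apply: cvgV; last exact: continuous_horner.
  have := kernel_neq0 tab; rewrite kernel_arg_parts => nz.
  apply: contra nz; rewrite [(pr ^+ 2 + _).[t]]hornerD !horner_exp.
  rewrite paddr_eq0 ?sqr_ge0// !sqrf_eq0.
  by move=> /andP[/eqP-> /eqP->].
Qed.

Lemma stieltjes_expansion :
  power_series_sum (fun k => (moment a b g k)%:C) z (stieltjes a b g z).
Proof.
have q01 : 0 <= q < 1 by rewrite mulr_ge0 ?cmod_ge0.
apply: (power_series_sum_geometric (B := 2 * (M * (b - a) / (1 - q))) q01) => k.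
have mRe : measurable_fun (`[a, b]%classic : set (measurableTypeR R))
    (@complex.Re R \o kernel).
  have := measurable_quotient pr; congr measurable_fun; apply/funext => t /=.
  by rewrite /kernel Re_inv kernel_arg_parts.
have mIm : measurable_fun (`[a, b]%classic : set (measurableTypeR R))
    (@complex.Im R \o kernel).
  have := measurable_quotient (- pi); congr measurable_fun; apply/funext => t /=.
  by rewrite /kernel Im_inv kernel_arg_parts hornerN.
have hRe := part_remainder erefl (@ReD R) (@ReMr R) (@Re_le_cmod R) mRe k.
have hIm := part_remainder erefl (@ImD R) (@ImMr R) (@Im_le_cmod R) mIm k.
have -> : 2 * (M * (b - a) / (1 - q)) * q ^+ k =
    M * (b - a) / (1 - q) * q ^+ k + M * (b - a) / (1 - q) * q ^+ k by ring.
have ReB w1 w2 : complex.Re (w1 - w2) = complex.Re w1 - complex.Re w2 :> R.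
  by case: w1; case: w2.
have ImB w1 w2 : complex.Im (w1 - w2) = complex.Im w1 - complex.Im w2 :> R.
  by case: w1; case: w2.
apply: le_trans (cmod_le_parts _) (lerD _ _).
  rewrite ReB Re_sum.
  by under [X in `|_ - X|]eq_bigr do rewrite mulrC ReMr.
rewrite ImB Im_sum.
by under [X in `|_ - X|]eq_bigr do rewrite mulrC ImMr.
Qed.

End StieltjesExpansion.

(** * Taylor domination *)

Section RootGrowth.
Context {R : realType}.

(** Convergence at some z with |z| > rho / (1 + e) gives |c_k| <= C |z|^-k, so that
    rho^k |c_k| / D is at most (1 + e)^k for large k. *)
Lemma subexponential_radius (c : nat -> R[i]) (rho D : R) : 0 < rho -> 0 < D ->
  rho%:E = convergence_radius c ->
  subexponential (fun k => rho ^+ k * cmod (c k) * D^-1).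
Proof.
move=> rho0 D0 rhoE; apply: limn_esup_le1 => e e0.
have e1 : 0 < 1 + e by rewrite addr_gt0.
have : ((rho / (1 + e))%:E < convergence_radius c)%E.
  by rewrite -rhoE lte_fin ltr_pdivrMr// ltr_pMr// ltrDl.
case/ereal_sup_gt => _ [z [s zs] <-]; rewrite lte_fin => zbig.
have z0 : 0 < cmod z by apply: lt_trans zbig; rewrite divr_gt0.
have [C hC] := power_series_sum_bounded zs.
pose C1 := `|C| + 1; have C10 : 0 < C1 by rewrite ltr_wpDl.
have wlt : rho / cmod z / (1 + e) < 1.
  by rewrite ltr_pdivrMr// mul1r ltr_pdivrMr// mulrC -ltr_pdivrMr.
have [||K hK] := @expr_eventually_lt R (rho / cmod z / (1 + e)) (D / C1).
- by rewrite wlt andbT !divr_ge0// ltW.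
- by rewrite divr_gt0.
exists K.+1 => // k /= Kk; rewrite lee_fin.
have k0 : (0 < k)%N by case: k Kk.
have hk := hK k (ltnW Kk).
have S0 : 0 <= rho ^+ k * cmod (c k) * D^-1.
  by rewrite !mulr_ge0 ?exprn_ge0 ?invr_ge0 ?cmod_ge0 ?(ltW rho0) ?(ltW D0).
have Sle : rho ^+ k * cmod (c k) * D^-1 <= (1 + e) ^+ k.
  rewrite ler_pdivrMr//.
  have ck : cmod (c k) <= C1 / cmod z ^+ k.
    rewrite ler_pdivlMr ?exprn_gt0//; apply: le_trans (hC k) _.
    by rewrite (le_trans (ler_norm _))// lerDl.
  apply: le_trans (ler_wpM2l (exprn_ge0 _ (ltW rho0)) ck) _.
  move: hk; rewrite !expr_div_n ltr_pdivrMr ?exprn_gt0// => /ltW.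
  by rewrite mulrAC ler_pdivlMr// mulrA mulrAC [leRHS]mulrC.
apply: le_trans (ge0_ler_powR _ _ _ Sle) _; rewrite ?nnegrE ?invr_ge0 ?exprn_ge0 ?(ltW e1)//.
by rewrite -powR_mulrn ?(ltW e1)// -powRrM mulfV ?powRr1 ?(ltW e1)// pnatr_eq0 -lt0n.
Qed.

End RootGrowth.

Theorem theorem6p4 (R : realType) (a b : R) (n : nat) (P : nat -> {poly R[i]})
  (p : nat) (x : nat -> R) (g : R -> R)
  (hab : a < b) (hn : (0 < n)%N) (hP : P n != 0)
  (hg : class_PD a b n P p x g)
  (hg0 : exists2 i : nat, (i <= p)%N &
           exists2 t : R, x i < t < x i.+1 & g t != 0)
  (hF : fuchsian n P) :
  let m := moment a b g in
  let c := fun k : nat => (m k)%:C in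
  let rho := convergence_radius c in
  let tau := (n * (p + 2))%N in
  let d_n := (size (P n)).-1 in
  [/\ has_power_series_at0 (stieltjes a b g) c,
      (Rstar n P p x <= rho)%E,
      rho \is a fin_num &
      exists2 N0 : nat,
        m N0 != 0 /\ (forall k : nat, (k < N0)%N -> m k = 0) &
        forall N : nat,
          (maxn tau.-1 (Lambda n P))%:Z + d_n%:Z - n%:Z <= N%:Z ->
          taylor_domination c N (fine rho)
            (fun k : nat => fine rho ^+ k * `|m k| *
                            (`|m N0| * fine rho ^+ N0)^-1)].
Proof.
move=> m c rho tau d_n.
have [[xa xb] xinc [[M gM] ig] _ hode] := hg.
have aleb := ltW hab.
have xmono k l : (k <= l <= p.+1)%N -> x k <= x l by exact: nodes_le.
have [eps eps0 growth] : exists2 eps : R, 0 < eps &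
    forall C, exists k, C * eps ^+ k < `|m k|.
  have [i ip [t /andP[t1 t2] gt]] := hg0.
  apply: (moment_growth (t0 := t) ig gM) => //.
    apply/andP; split.
      by rewrite (le_lt_trans _ t1)// -xa xmono//= leqW.
    by rewrite (lt_le_trans t2)// -xb xmono//= ltnS ip /=.
  by have [gc _] := hode i ip; apply: gc; rewrite t1.
have [k0 mk0] : exists k, m k != 0.
  by have [k] := growth 0; rewrite mul0r normr_gt0; exists k.
pose c0 := Num.max `|a| `|b|.
have tc0 t : a <= t <= b -> `|t| <= c0.
  move=> /andP[ta tb]; rewrite /c0 le_max; have [t0|t0] := leP 0 t.
    by rewrite (ger0_norm t0) (ger0_norm (le_trans t0 tb)) tb orbT.
  by rewrite (ltr0_norm t0) (ler0_norm (le_trans ta (ltW t0))) lerN2 ta.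
have c00 : 0 < c0.
  rewrite lt_max !normr_gt0 -negb_and; apply/negP => /andP[/eqP a0 /eqP b0].
  by move: hab; rewrite a0 b0 ltxx.
have expansion z : cmod z * c0 < 1 -> power_series_sum c z (stieltjes a b g z).
  exact: stieltjes_expansion aleb ig gM tc0 (ltW c00).
(* Every z with |z| < 1 / c0 is a point of convergence. *)
have rho_ge : (c0^-1%:E <= rho)%E.
  rewrite leNgt; apply/negP => rho_lt.
  have rho0 : (0%:E <= rho)%E.
    have := @convergence_radius_ge _ c 0 _ (expansion 0 _).
    by rewrite ComplexField.Normc.normc0 mul0r => /(_ ltr01).
  have rhofin : rho \is a fin_num by rewrite ge0_fin_numE// (lt_trans rho_lt) ?ltry.
  move: rho_lt rho0; rewrite -(fineK rhofin) lte_fin lee_fin => rho_lt rho0.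
  pose r := (fine rho + c0^-1) / 2.
  have r0 : 0 <= r by rewrite divr_ge0// addr_ge0// invr_ge0 ltW.
  have rc : cmod r%:C * c0 < 1.
    by rewrite cmodR ger0_norm// -ltr_pdivlMr// mul1r /r; lra.
  have := convergence_radius_ge (expansion _ rc).
  by rewrite cmodR ger0_norm// -/rho -(fineK rhofin) lee_fin /r; lra.
(* Convergence at z with |z| > 1 / eps would contradict the growth of the moments. *)
have rho_le : (rho <= (eps^-1)%:E)%E.
  apply: ge_ereal_sup => _ [z [s zs] <-]; rewrite lee_fin leNgt; apply/negP => zbig.
  have [C hC] := power_series_sum_bounded zs.
  have [k hk] := growth `|C|.
  have ez : 1 <= eps * cmod z by rewrite -ler_pdivrMl// mulr1 ltW.
  have := le_trans (hC k) (ler_norm C); rewrite /c cmodR; apply/negP; rewrite -ltNge.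
  apply: (@le_lt_trans _ _ (`|C| * (eps * cmod z) ^+ k)).
    by rewrite ler_peMr// exprn_ege1.
  rewrite exprMn mulrA ltr_pM2r ?exprn_gt0//.
  by apply: lt_trans zbig; rewrite invr_gt0.
have rhofin : rho \is a fin_num.
  rewrite fin_numElt; apply/andP; split; first exact: lt_le_trans (ltNyr _) rho_ge.
  exact: le_lt_trans rho_le (ltry _).
split => //.
- exists c0^-1; first by rewrite invr_gt0.
  by move=> z zc; apply: expansion; rewrite -ltr_pdivlMr// mul1r.
- apply: le_trans rho_ge; apply: ereal_inf_lbound.
  (* c0 is the modulus of one of the endpoints x 0 = a and x p.+1 = b. *)
  have aux i : (i <= p.+1)%N -> `|x i| = c0 ->
      exists2 xi, singular_set n P p x xi & inv_modulus xi = c0^-1%:E.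
    move=> ip xi; exists (x i)%:C; first by right; exists i.
    by rewrite /inv_modulus -[_ == _]negbK -cmod_gt0 cmodR xi c00.
  have [ab|ba] := leP `|a| `|b|.
    by apply: (aux p.+1) => //; rewrite xb /c0; apply/esym/max_idPr.
  by apply: (aux 0%N) => //; rewrite xa /c0; apply/esym/max_idPl/ltW.
have ex : exists k, m k != 0 by exists k0.
case: (ex_minnP ex) => N0 mN0 N0min.
have below k : (k < N0)%N -> m k = 0.
  by move=> kN; apply/eqP; apply: contraLR kN; rewrite -leqNgt; exact: N0min.
exists N0 => // N hN.
have N0N : (N0 <= N)%N.
  rewrite leqNgt; apply/negP => NN0.
  have all0 : forall j, m j = 0.
    apply: (moments_eq0 hP hg hF hN) => j jN; apply: below; exact: leq_ltn_trans NN0.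
  by move: mk0; rewrite all0 eqxx.
pose r := fine rho; have rE : r%:E = rho by rewrite fineK.
have r0 : 0 < r by rewrite -lte_fin rE (lt_le_trans _ rho_ge)// lte_fin invr_gt0.
have D0 : 0 < `|m N0| * r ^+ N0 by rewrite mulr_gt0 ?normr_gt0 ?exprn_gt0.
split.
- by split => //; rewrite rE.
- by move=> k; rewrite !mulr_ge0 ?invr_ge0 ?exprn_ge0 ?(ltW D0) ?(ltW r0).
- have := subexponential_radius r0 D0 rE; congr subexponential; apply/funext => k.
  by rewrite /c cmodR.
- move=> k Nk; rewrite /c cmodR.
  have top : `|m N0| * r ^+ N0 <=
      \big[Num.max/0]_(i < N.+1) (cmod (m i)%:C * r ^+ i).
    rewrite -[X in X * _ <= _]cmodR.
    have N0N1 : (N0 < N.+1)%N by [].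
    exact: (le_bigmax 0 (fun i : 'I_N.+1 => cmod (m i)%:C * r ^+ i) (Ordinal N0N1)).
  rewrite -/r; apply: le_trans (ler_wpM2l _ top).
    by rewrite divfK ?gt_eqF// mulrC.
  by rewrite !mulr_ge0 ?invr_ge0 ?exprn_ge0 ?(ltW D0) ?(ltW r0).
Qed.
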